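(* Let $\mathcal F$ be a commutative Hopf algebra in duality (Hopf pairing) with the enveloping Hopf algebra $U(\mathfrak g)$ of a Lie algebra $\mathfrak g$, and assume that $\mathfrak g=\mathfrak h\ltimes\mathfrak l$ is an $\mathcal F$-Levi decomposition. Then, for any $\mathcal F$-comodule $V$, the map $\theta_{\mathcal F,\mathfrak l,0}$ induces an isomorphism between the periodic Hopf cyclic cohomology of $\mathcal F$ with coefficients in $V$ and the relative Lie algebra cohomology of $\mathfrak h\subseteq\mathfrak g$ with coefficients in $V$. In other words, $$HP^\bullet(\mathcal F,V)\cong\bigoplus_{i\equiv\bullet \bmod 2}H^i(\mathfrak g,\mathfrak h,V).$$
   Context: Everything is over $\mathbb C$; Lie algebras are finite dimensional. Sweedler notation $\Delta(h)=h_{(1)}\otimes h_{(2)}$; left coactions $v\mapsto v_{<-1>}\otimes v_{<0>}$ (a right comodule $v\mapsto v_{<0>}\otimes v_{<1>}$ is regarded as a left comodule by $v\mapsto S(v_{<1>})\otimes v_{<0>}$). **Hopf pairing.** A bilinear $\langle\,,\rangle:\mathcal F\otimes U(\mathfrak g)\to\mathbb C$ with $\langle f,vw\rangle=\langle f_{(1)},v\rangle\langle f_{(2)},w\rangle$, $\langle f,1\rangle=\varepsilon(f)$, $\langle fg,v\rangle=\langle f,v_{(1)}\rangle\langle g,v_{(2)}\rangle$, $\langle1,v\rangle=\varepsilon(v)$, $\langle S(f),v\rangle=\langle f,S(v)\rangle$. An $\mathcal F$-comodule $V$ becomes a $\mathfrak g$-module through the pairing: $vX=\langle v_{<-1>},X\rangle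 v_{<0>}$ (right module). **Hopf cyclic cohomology.** $V$ is given the trivial right action $v\cdot f=\varepsilon(f)v$ (it is then a stable anti-Yetter–Drinfeld module over $\mathcal F$). $C^q(\mathcal F,V)=V\otimes\mathcal F^{\otimes q}$ is the cocyclic module with $\partial_0(v\otimes f^1\otimes\cdots\otimes f^q)=v\otimes1\otimes f^1\otimes\cdots\otimes f^q$, $\partial_i$ applying $\Delta$ to $f^i$ ($1\le i\le q$), $\partial_{q+1}=v_{<0>}\otimes f^1\otimes\cdots\otimes f^q\otimes v_{<-1>}$, $\sigma_j$ applying $\varepsilon$ to $f^{j+1}$, and $\tau(v\otimes f^1\otimes\cdots\otimes f^q)=v_{<0>}\otimes S(f^1)\cdot(f^2\otimes\cdots\otimes f^q\otimes v_{<-1>})$ (diagonal action by multiplication). $b=\sum_i(-1)^i\partial_i$; $(C^\bullet(\mathcal F,V),b)$ is the Hochschild complex of the coalgebra $\mathcal F$. $HP^\bullet(\mathcal F,V)$ is the periodic cyclic cohomology: the cohomology of the $\mathbb Z/2$-graded complex $(\bigoplus_{q\equiv\bullet}C^q,b+B)$ with $B$ the Connes operator, given on normalized cochains by $B=\big(\sum_{i=0}^{q-1}(-1)^{(q-1)i}\tau^i\big)\sigma_{q-1}\tau$. **$\mathcal F$-Levi decomposition.** $\mathfrak g=\mathfrak h\ltimes\mathfrak l$ where $\mathfrak h$ is a reductive subalgebra all of whose finite dimensional representations are semisimple, and $\mathfrak l$ is an ideal. For an $\mathcal F$-comodule $V$ define $\theta_{\mathcal F,\mathfrak l,0}:V\otimes\mathcal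 F^{\otimes q}\to(V\otimes\wedge^q\mathfrak l^* )^{\mathfrak h}$ as the map $v\otimes f^1\otimes\cdots\otimes f^q\mapsto\big[(\xi_1,\dots,\xi_q)\mapsto\sum_{s\in S_q}(-1)^s\langle f^1,\xi_{s(1)}\rangle\cdots\langle f^q,\xi_{s(q)}\rangle v\big]$, $\xi_i\in\mathfrak l$, followed by the projection onto the weight $0$ ($\mathfrak h$-invariant) part. It is a map of complexes from the Hochschild complex $(V\otimes\mathcal F^{\otimes\bullet},b)$ to the $\mathfrak h$-invariant part of the Chevalley–Eilenberg complex $C^\bullet(\mathfrak l,V)$, which is identified with the relative Chevalley–Eilenberg complex $C^\bullet(\mathfrak g,\mathfrak h,V)\cong(V\otimes\wedge^\bullet(\mathfrak g/\mathfrak h)^* )^{\mathfrak h}$. The decomposition is called an $\mathcal F$-Levi decomposition if $\theta_{\mathcal F,\mathfrak l,0}$ is a quasi-isomorphism for every $\mathcal F$-comodule $V$. $H^\bullet(\mathfrak g,\mathfrak h,V)$ is relative Lie algebra cohomology. *)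

(* Defs.v *)
From HB Require Import structures.
From mathcomp Require Import all_boot all_order all_algebra generic_quotient.
From mathcomp Require Import ring_quotient perm.
From mathcomp Require Import boolp classical_sets functions reals.
From mathcomp Require Import finmap monalg complex.

Set Implicit Arguments.
Unset Strict Implicit.
Unset Printing Implicit Defensive.

Import GRing.Theory.

Local Open Scope ring_scope.
Local Open Scope quotient_scope.

Record subspace (K : fieldType) (M : lmodType K) : Type := Subspace {
  sub_pred :> {pred M};
  sub_closed : submod_closed sub_pred }.

HB.instance Definition _ (K : fieldType) (M : lmodType K) (S : subspace M) :=
  GRing.isSubmodClosed.Build K M (sub_pred S) (sub_closed S).

Section Subspaces.
Variables (K : fieldType) (M : lmodType K).

Definition subspace_set (P : set M) : Prop :=
  P 0 /\ forall (a : K) u v, P u -> P v -> P (a *: u + v).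

Definition set_pred (P : set M) : {pred M} := fun x => `[< P x >].

Lemma set_pred_closed (P : set M) :
  subspace_set P -> submod_closed (set_pred P).
Proof.
case=> P0 PD; split=> [|a u v]; rewrite !unfold_in; first exact/asboolP.
by move=> /asboolP Pu /asboolP Pv; apply/asboolP; apply: PD.
Qed.

Definition mk_subspace (P : set M) (hP : subspace_set P) : subspace M :=
  Subspace (set_pred_closed hP).

Lemma mk_subspaceP (P : set M) (hP : subspace_set P) (x : M) :
  reflect (P x) (x \in mk_subspace hP).
Proof. exact: asboolP. Qed.

Definition span_set (X : set M) : set M :=
  fun x => forall S : subspace M, (forall y, X y -> y \in S) -> x \in S.

Lemma span_subspace X : subspace_set (span_set X).
Proof.
split=> [S _|a u v hu hv S hS]; first exact: rpred0.
by rewrite rpredD ?rpredZ ?hu ?hv.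
Qed.

Definition span X : subspace M := mk_subspace (span_subspace X).

End Subspaces.

Section Quotients.
Variables (K : fieldType) (M : lmodType K) (S : subspace M).

Definition quotm : Type := Quotient.quot S.
HB.instance Definition _ := Choice.on quotm.
HB.instance Definition _ := EqQuotient.on quotm.

Definition quotm_zero : quotm := @Quotient.zero M S.
Definition quotm_add : quotm -> quotm -> quotm := @Quotient.add M S.
Definition quotm_opp : quotm -> quotm := @Quotient.opp M S.

HB.instance Definition _ := GRing.isZmodule.Build quotm
  (@Quotient.addqA M S : associative quotm_add)
  (@Quotient.addqC M S : commutative quotm_add)
  (@Quotient.add0q M S : left_id quotm_zero quotm_add)
  (@Quotient.addNq M S : left_inverse quotm_zero quotm_opp quotm_add).

Definition qpi (x : M) : quotm := \pi_quotm x.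

Lemma qpiK (x : quotm) : qpi (repr x) = x.
Proof. exact: reprK. Qed.

Lemma qpi_eq (x y : M) : (qpi x == qpi y) = (x - y \in S).
Proof. by rewrite /qpi -Quotient.idealrBE. Qed.

Lemma qpiD (x y : M) : qpi (x + y) = qpi x + qpi y.
Proof. exact: (Quotient.pi_add S). Qed.

Definition quotm_scale (a : K) (x : quotm) : quotm := qpi (a *: repr x).

Lemma qpiZ a x : quotm_scale a (qpi x) = qpi (a *: x).
Proof.
apply/eqP; rewrite qpi_eq -scalerBr rpredZ // -qpi_eq.
by rewrite qpiK.
Qed.

Fact quotm_scaleA a b x :
  quotm_scale a (quotm_scale b x) = quotm_scale (a * b) x.
Proof. by rewrite -(qpiK x) !qpiZ scalerA. Qed.

Fact quotm_scale1 x : quotm_scale 1 x = x.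
Proof. by rewrite -(qpiK x) qpiZ scale1r. Qed.

Fact quotm_scaleDr a x y :
  quotm_scale a (x + y) = quotm_scale a x + quotm_scale a y.
Proof. by rewrite -(qpiK x) -(qpiK y) -qpiD !qpiZ scalerDr qpiD. Qed.

Fact quotm_scaleDl x a b :
  quotm_scale (a + b) x = quotm_scale a x + quotm_scale b x.
Proof. by rewrite -(qpiK x) !qpiZ scalerDl qpiD. Qed.

HB.instance Definition _ := GRing.Zmodule_isLmodule.Build K quotm
  quotm_scaleA quotm_scale1 quotm_scaleDr quotm_scaleDl.

Lemma qpi_is_linear : linear qpi.
Proof. by move=> a x y; rewrite qpiD -qpiZ. Qed.

HB.instance Definition _ := GRing.isLinear.Build K M quotm _ qpi qpi_is_linear.

End Quotients.

#[global] Opaque quotm_zero quotm_add quotm_opp quotm_scale qpi.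

Section Subtypes.
Variables (K : fieldType) (M : lmodType K) (S : subspace M).

Record subm : Type := SubM { subm_val :> M; _ : subm_val \in S }.
HB.instance Definition _ := [isSub for subm_val].
HB.instance Definition _ := [Choice of subm by <:].
HB.instance Definition _ := [SubChoice_isSubLmodule of subm by <:].

End Subtypes.

(* The cohomology Z/B of the pair B <= Z; only Z :&: B matters for the
   definition, so that no proof of B <= Z has to be carried. *)
Section Subquotients.
Variables (K : fieldType) (M : lmodType K) (Z B : subspace M).

Lemma sub_in_subspace : subspace_set (fun x : subm Z => val x \in B).
Proof.
split=> [|a u v Bu Bv]; first by rewrite raddf0 rpred0.
by rewrite linearP rpredD ?rpredZ.
Qed.

Definition subquot : Type := quotm (mk_subspace sub_in_subspace).
HB.instance Definition _ := GRing.Lmodule.on subquot.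

Definition class_of (z : subm Z) : subquot := qpi _ z.

Definition has_class (c : subquot) (x : M) : Prop :=
  exists z : subm Z, val z = x /\ class_of z = c.

End Subquotients.

Definition induces_iso (K : fieldType) (M N : lmodType K) (Z B : subspace M)
    (Z' B' : subspace N) (f : M -> N) : Prop :=
  exists F : {linear subquot Z B -> subquot Z' B'},
    bijective F /\ forall c x, has_class c x -> has_class (F c) (f x).

Section FreeQuotient.
Variables (K : fieldType) (X : choiceType) (rel : set {malg K[X]}).

Definition fquot : Type := quotm (span rel).
HB.instance Definition _ := GRing.Lmodule.on fquot.

Definition fgen (x : X) : fquot := qpi _ << x >>.

Definition malg_lift (N : lmodType K) (phi : X -> N) (m : {malg K[X]}) : N :=
  \sum_(x <- msupp m) m@_x *: phi x.

(* Meaningful when malg_lift phi vanishes on rel, see flift_linear and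
   flift_gen; total so that maps can be written before their
   multilinearity is proved. *)
Definition flift (N : lmodType K) (phi : X -> N) (t : fquot) : N :=
  malg_lift phi (repr t).

Lemma malg_lift_is_linear (N : lmodType K) (phi : X -> N) :
  linear (malg_lift phi).
Proof.
move=> a u v.
have liftw (m : {malg K[X]}) (d : {fset X}) : (msupp m `<=` d)%fset ->
    malg_lift phi m = \sum_(x <- d) m@_x *: phi x.
  move=> le_md; rewrite /malg_lift (big_fset_incl _ le_md) // => x _.
  by move/mcoeff_outdom->; rewrite scale0r.
pose d := (msupp (a *: u + v) `|` (msupp u `|` msupp v))%fset.
rewrite (liftw (a *: u + v) d) ?fsubsetUl //.
rewrite (liftw u d); last first.
  by rewrite /d fsetUCA fsubsetUl.
rewrite (liftw v d); last first.
  by rewrite /d fsetUA fsubsetUr.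
rewrite scaler_sumr -big_split; apply: eq_bigr => x _ /=.
by rewrite mcoeffD mcoeffZ scalerDl scalerA.
Qed.

HB.instance Definition _ (N : lmodType K) (phi : X -> N) :=
  GRing.isLinear.Build K {malg K[X]} N _ (malg_lift phi)
    (malg_lift_is_linear phi).

Lemma malg_liftU (N : lmodType K) (phi : X -> N) (x : X) :
  malg_lift phi << x >> = phi x.
Proof.
rewrite /malg_lift msuppU (negPf (oner_neq0 _)).
by rewrite big_seq_fset1 mcoeffUU scale1r.
Qed.

Section Lift.
Variables (N : lmodType K) (phi : X -> N).
Hypothesis phi0 : forall r, rel r -> malg_lift phi r = 0.

Lemma flift_pi m : flift phi (qpi _ m) = malg_lift phi m.
Proof.
have ker_sub : subspace_set (fun m => malg_lift phi m = 0).
  split=> [|a u v u0 v0]; first by rewrite raddf0.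
  by rewrite linearP /= u0 v0 scaler0 addr0.
apply/eqP; rewrite -subr_eq0 -raddfB /=; apply/eqP.
have : repr (qpi (span rel) m) - m \in span rel by rewrite -qpi_eq qpiK.
move/(mk_subspaceP (span_subspace rel)) => /(_ (mk_subspace ker_sub)) h.
apply/(mk_subspaceP ker_sub); apply: h => y /phi0 hy.
exact/(mk_subspaceP ker_sub).
Qed.

Lemma flift_linear : linear (flift phi).
Proof.
move=> a u v; rewrite -(qpiK u) -(qpiK v) -linearP /=.
by rewrite !flift_pi linearP.
Qed.

Lemma flift_gen x : flift phi (fgen x) = phi x.
Proof. by rewrite flift_pi malg_liftU. Qed.

End Lift.

Lemma flift_phi_linear (N : lmodType K) (a : K) (phi psi : X -> N) t :
  flift (fun x => a *: phi x + psi x) t = a *: flift phi t + flift psi t.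
Proof.
rewrite /flift /malg_lift scaler_sumr -big_split; apply: eq_bigr => x _ /=.
by rewrite scalerDr !scalerA mulrC.
Qed.

End FreeQuotient.

Section Tensor.
Variables (K : fieldType) (V W : lmodType K).

Inductive tens_rel : set {malg K[(V * W)%type]} :=
| TensRelL a v v' w :
    tens_rel (<< (a *: v + v', w) >> - (a *: << (v, w) >> + << (v', w) >>))
| TensRelR a v w w' :
    tens_rel (<< (v, a *: w + w') >> - (a *: << (v, w) >> + << (v, w') >>)).

Definition tens : Type := fquot tens_rel.
HB.instance Definition _ := GRing.Lmodule.on tens.

Definition tpure (v : V) (w : W) : tens := fgen tens_rel (v, w).

(* If t = \sum_i v_i (x) w_i then tlift phi t = \sum_i phi v_i w_i, for
   phi bilinear. *)
Definition tlift (N : lmodType K) (phi : V -> W -> N) (t : tens) : N :=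
  flift (fun p => phi p.1 p.2) t.

Definition bilin (N : lmodType K) (phi : V -> W -> N) : Prop :=
  (forall w, linear (phi^~ w)) /\ (forall v, linear (phi v)).

Section Lift.
Variables (N : lmodType K) (phi : V -> W -> N).
Hypothesis phiP : bilin phi.

Lemma tens_rel0 r :
  tens_rel r -> malg_lift (fun p => phi p.1 p.2) r = 0.
Proof.
case=> [a v v' w|a v w w']; rewrite linearB linearP /= !malg_liftU /=.
  by rewrite phiP.1 subrr.
by rewrite phiP.2 subrr.
Qed.

Lemma tlift_linear : linear (tlift phi).
Proof. exact: (flift_linear tens_rel0). Qed.

Lemma tlift_pure v w : tlift phi (tpure v w) = phi v w.
Proof. exact: (flift_gen tens_rel0). Qed.

End Lift.

Lemma tlift_phi_linear (N : lmodType K) (a : K) (phi psi : V -> W -> N) t :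
  tlift (fun v w => a *: phi v w + psi v w) t
  = a *: tlift phi t + tlift psi t.
Proof. exact: flift_phi_linear. Qed.

Lemma eq_tlift (N : lmodType K) (phi psi : V -> W -> N) t :
  (forall v w, phi v w = psi v w) -> tlift phi t = tlift psi t.
Proof. by move=> eq_f; rewrite (_ : phi = psi) //; apply/funext => v; apply/funext. Qed.

Lemma tpure_bilin : bilin tpure.
Proof.
split=> [w a u v|v a u w]; apply/eqP.
  rewrite -subr_eq0 -linearP -linearB /= -[X in _ == X](raddf0 (qpi _)) qpi_eq.
  by rewrite subr0; apply/mk_subspaceP => S; apply; apply: TensRelL.
rewrite -subr_eq0 -linearP -linearB /= -[X in _ == X](raddf0 (qpi _)) qpi_eq.
by rewrite subr0; apply/mk_subspaceP => S; apply; apply: TensRelR.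
Qed.

End Tensor.

#[global] Opaque tens tlift tpure.

Section FamilyOps.
Variable T : Type.

Definition fupd q (i : 'I_q) (x : T) (f : {ffun 'I_q -> T}) :
  {ffun 'I_q -> T} := [ffun j => if j == i then x else f j].

Definition fdel q (i : 'I_q.+1) (f : {ffun 'I_q.+1 -> T}) :
  {ffun 'I_q -> T} := [ffun j => f (lift i j)].

(* x becomes the i-th entry, the entries of f from i on are shifted. *)
Definition fins q (i : 'I_q.+1) (x : T) (f : {ffun 'I_q -> T}) :
  {ffun 'I_q.+1 -> T} := [ffun j => oapp f x (unlift i j)].

Lemma fins_upd q (i : 'I_q.+1) k x y f :
  fins i y (fupd k x f) = fupd (lift i k) x (fins i y f).
Proof.
apply/ffunP=> j; rewrite !ffunE; case: unliftP => [j' ->|->] /=.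
  by rewrite ffunE (inj_eq lift_inj).
by rewrite (negPf (neq_lift _ _)).
Qed.

Lemma fins_updE q (i : 'I_q.+1) x y f : fins i x f = fupd i x (fins i y f).
Proof.
apply/ffunP=> j; rewrite !ffunE; case: unliftP => [j' ->|->] /=.
  by rewrite eq_sym (negPf (neq_lift _ _)).
by rewrite eqxx.
Qed.

Lemma fupd_same q (i : 'I_q) x f : fupd i x f i = x.
Proof. by rewrite ffunE eqxx. Qed.

Lemma fupd_other q (i j : 'I_q) x f : j != i -> fupd i x f j = f j.
Proof. by rewrite ffunE => /negPf->. Qed.

Lemma fupd_upd q (i : 'I_q) x y f : fupd i x (fupd i y f) = fupd i x f.
Proof. by apply/ffunP=> j; rewrite !ffunE; case: eqP. Qed.

Lemma fupdC q (i k : 'I_q) x y f : i != k ->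
  fupd i x (fupd k y f) = fupd k y (fupd i x f).
Proof.
move=> ik; apply/ffunP=> j; rewrite !ffunE.
by case: eqP => // ->; rewrite (negPf ik).
Qed.

Lemma fdel_upd_same q (i : 'I_q.+1) x f : fdel i (fupd i x f) = fdel i f.
Proof.
by apply/ffunP=> j; rewrite !ffunE eq_sym (negPf (neq_lift _ _)).
Qed.

Lemma fdel_upd q (i : 'I_q.+1) k x f :
  fdel i (fupd (lift i k) x f) = fupd k x (fdel i f).
Proof. by apply/ffunP=> j; rewrite !ffunE (inj_eq lift_inj). Qed.

End FamilyOps.

Section MultiTensor.
Variables (K : fieldType) (V F : lmodType K).

Definition slotwise_linear (N : lmodType K) q (phi : {ffun 'I_q -> F} -> N) :=
  forall i f, linear (fun x => phi (fupd i x f)).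

Definition multilin (N : lmodType K) q (phi : V -> {ffun 'I_q -> F} -> N) :=
  (forall f, linear (phi^~ f)) /\ (forall v, slotwise_linear (phi v)).

Lemma fins_linear (N : lmodType K) q (phi : {ffun 'I_q.+1 -> F} -> N) i f :
  slotwise_linear phi -> linear (fun x => phi (fins i x f)).
Proof.
move=> phiP a x y /=; have := phiP i (fins i 0 f) a x y.
by rewrite -!fins_updE.
Qed.

Inductive mtens_rel q : set {malg K[(V * {ffun 'I_q -> F})%type]} :=
| MtensRelV a v v' f :
    mtens_rel (<< (a *: v + v', f) >> - (a *: << (v, f) >> + << (v', f) >>))
| MtensRelF i a x x' v f :
    mtens_rel (<< (v, fupd i (a *: x + x') f) >>
               - (a *: << (v, fupd i x f) >> + << (v, fupd i x' f) >>)).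

(* V (x) F (x) ... (x) F with q factors F. *)
Definition mtens q : Type := fquot (@mtens_rel q).
HB.instance Definition _ q := GRing.Lmodule.on (mtens q).

Definition mpure q (v : V) (f : {ffun 'I_q -> F}) : mtens q :=
  fgen (@mtens_rel q) (v, f).

Definition mlift (N : lmodType K) q (phi : V -> {ffun 'I_q -> F} -> N)
  (t : mtens q) : N := flift (fun p => phi p.1 p.2) t.

Section Lift.
Variables (N : lmodType K) (q : nat) (phi : V -> {ffun 'I_q -> F} -> N).
Hypothesis phiP : multilin phi.

Lemma mtens_rel0 r :
  mtens_rel r -> malg_lift (fun p => phi p.1 p.2) r = 0.
Proof.
case=> [a v v' f|i a x x' v f]; rewrite linearB linearP /= !malg_liftU /=.
  by rewrite phiP.1 subrr.
by rewrite phiP.2 subrr.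
Qed.

Lemma mlift_linear : linear (mlift phi).
Proof. exact: (flift_linear mtens_rel0). Qed.

Lemma mlift_pure v f : mlift phi (mpure v f) = phi v f.
Proof. exact: (flift_gen mtens_rel0). Qed.

End Lift.

Lemma mpure_multilin q : multilin (@mpure q).
Proof.
split=> [f a u v|v i f a u w]; apply/eqP.
  rewrite -subr_eq0 -linearP -linearB /= -[X in _ == X](raddf0 (qpi _)) qpi_eq.
  by rewrite subr0; apply/mk_subspaceP => S; apply; apply: MtensRelV.
rewrite -subr_eq0 -linearP -linearB /= -[X in _ == X](raddf0 (qpi _)) qpi_eq.
by rewrite subr0; apply/mk_subspaceP => S; apply; apply: MtensRelF.
Qed.

End MultiTensor.

#[global] Opaque mtens mlift mpure.

(* The Sweedler sum \sum a (x) b of an element t of V (x) W. *)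
Notation "'\sw_' ( a , b <- t ) E" := (tlift (fun a b => E) t)
  (at level 36, a name, b name, E at level 36,
   format "'[' \sw_ ( a ,  b  <-  t ) '/  '  E ']'") : ring_scope.

Section Hopf.
Variable K : fieldType.

Definition tens_mul (A : algType K) (s t : tens A A) : tens A A :=
  \sw_(a, b <- s) \sw_(c, d <- t) tpure (a * c) (b * d).

Record hopf (A : algType K) : Type := Hopf {
  comul : {linear A -> tens A A};
  counit : {scalar A};
  antip : {linear A -> A};
  comulA : forall f,
    \sw_(a, b <- comul f) \sw_(a', a'' <- comul a) tpure (tpure a' a'') b
    = \sw_(a, b <- comul f) \sw_(b', b'' <- comul b) tpure (tpure a b') b'';
  counitl : forall f, \sw_(a, b <- comul f) (counit a *: b) = f;
  counitr : forall f, \sw_(a, b <- comul f) (counit b *: a) = f;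
  comul1 : comul 1 = tpure 1 1;
  comulM : forall f g, comul (f * g) = tens_mul (comul f) (comul g);
  counit1 : counit 1 = 1;
  counitM : forall f g, counit (f * g) = counit f * counit g;
  antipl : forall f, \sw_(a, b <- comul f) (antip a * b) = (counit f)%:A;
  antipr : forall f, \sw_(a, b <- comul f) (a * antip b) = (counit f)%:A }.

Record comodule (F : algType K) (H : hopf F) : Type := Comodule {
  comod_space :> lmodType K;
  coact : {linear comod_space -> tens F comod_space};
  coactA : forall v,
    \sw_(f, w <- coact v) \sw_(f', f'' <- comul H f) tpure (tpure f' f'') w
    = \sw_(f, w <- coact v) \sw_(f', w' <- coact w) tpure (tpure f f') w';
  coact1 : forall v, \sw_(f, w <- coact v) (counit H f *: w) = v }.

Record lieAlg : Type := LieAlg {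
  lie_space :> vectType K;
  lie_br : lie_space -> lie_space -> lie_space;
  lie_brl : forall y, linear (lie_br^~ y);
  lie_brr : forall x, linear (lie_br x);
  lie_brxx : forall x, lie_br x x = 0;
  lie_jacobi : forall x y z,
    lie_br x (lie_br y z) + lie_br y (lie_br z x) + lie_br z (lie_br x y) = 0 }.

(* U(g), characterized up to isomorphism by its universal property; as
   comul is multiplicative, its values on g determine it. *)
Record enveloping (g : lieAlg) : Type := Enveloping {
  env_alg :> algType K;
  env_hopf : hopf env_alg;
  env_inj : {linear g -> env_alg};
  env_br : forall x y, env_inj (lie_br x y)
    = env_inj x * env_inj y - env_inj y * env_inj x;
  env_univ : forall (A : algType K) (phi : {linear g -> A}),
    (forall x y, phi (lie_br x y) = phi x * phi y - phi y * phi x) ->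
    exists2 Phi : {lrmorphism env_alg -> A},
      forall x, Phi (env_inj x) = phi x &
      forall Psi : {lrmorphism env_alg -> A},
        (forall x, Psi (env_inj x) = phi x) -> Psi =1 Phi;
  env_comul : forall x, comul env_hopf (env_inj x)
    = tpure (env_inj x) 1 + tpure 1 (env_inj x) }.

Record hopf_pairing (F U : algType K) (HF : hopf F) (HU : hopf U) : Type :=
  HopfPairing {
  pairing :> F -> U -> K;
  pairing_linl : forall u, scalar (pairing^~ u);
  pairing_linr : forall f, scalar (pairing f);
  pairingMr : forall f v w, pairing f (v * w)
    = \sw_(a, b <- comul HF f) (pairing a v * pairing b w : K^o);
  pairing1r : forall f, pairing f 1 = counit HF f;
  pairingMl : forall f g v, pairing (f * g) v
    = \sw_(a, b <- comul HU v) (pairing f a * pairing g b : K^o);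
  pairing1l : forall v, pairing 1 v = counit HU v;
  pairingS : forall f v,
    pairing (antip HF f) v = pairing f (antip HU v) }.

End Hopf.

Section Complexes.
Variable K : fieldType.

(* A cochain complex given, in each degree, as a subspace of an ambient
   space on which the differential is also defined. As subquot Z B only
   sees Z :&: B, the cohomology makes sense without d \o d = 0. *)
Record cochain_cpx : Type := CochainCpx {
  cpx_amb : nat -> lmodType K;
  cpx_sub : forall q, subspace (cpx_amb q);
  cpx_d : forall q, {linear cpx_amb q -> cpx_amb q.+1} }.

Variables (M N : lmodType K).

Lemma ker_subspace_set (S : subspace M) (f : {linear M -> N}) :
  subspace_set (fun x => x \in S /\ f x = 0).
Proof.
split=> [|a u v [uS u0] [vS v0]]; first by rewrite rpred0 raddf0.
by rewrite rpredD ?rpredZ // linearP /= u0 v0 scaler0 addr0.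
Qed.

Lemma img_subspace_set (S : subspace M) (f : {linear M -> N}) :
  subspace_set (fun y => exists2 x, x \in S & y = f x).
Proof.
split=> [|a _ _ [x xS ->] [y yS ->]]; first by exists 0; rewrite ?rpred0 ?raddf0.
by exists (a *: x + y); rewrite ?linearP ?rpredD ?rpredZ.
Qed.

Definition ker_in S f : subspace M := mk_subspace (ker_subspace_set S f).
Definition img_of S f : subspace N := mk_subspace (img_subspace_set S f).

Lemma zero_subspace_set : subspace_set (fun x : M => x = 0).
Proof. by split=> // a u v -> ->; rewrite scaler0 addr0. Qed.

Lemma full_subspace_set : subspace_set (fun x : M => True).
Proof. by []. Qed.

Definition zero_sub : subspace M := mk_subspace zero_subspace_set.
Definition full_sub : subspace M := mk_subspace full_subspace_set.

End Complexes.

Section Cohomology.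
Variable K : fieldType.

Definition cocycles (C : cochain_cpx K) q : subspace (cpx_amb C q) :=
  ker_in (cpx_sub C q) (cpx_d C q).

Definition coboundaries (C : cochain_cpx K) q : subspace (cpx_amb C q) :=
  match q with
  | 0 => zero_sub _
  | q'.+1 => img_of (cpx_sub C q') (cpx_d C q')
  end.

Definition cohomology (C : cochain_cpx K) q : Type :=
  subquot (cocycles C q) (coboundaries C q).
HB.instance Definition _ C q := GRing.Lmodule.on (cohomology C q).

Definition cochain_map (C D : cochain_cpx K)
    (f : forall q, cpx_amb C q -> cpx_amb D q) : Prop :=
  [/\ forall q (a : K) x y, x \in cpx_sub C q -> y \in cpx_sub C q ->
        f q (a *: x + y) = a *: f q x + f q y,
      forall q x, x \in cpx_sub C q -> f q x \in cpx_sub D q &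
      forall q x, x \in cpx_sub C q -> f q.+1 (cpx_d C q x) = cpx_d D q (f q x)].

Definition quasi_iso (C D : cochain_cpx K)
    (f : forall q, cpx_amb C q -> cpx_amb D q) : Prop :=
  cochain_map f /\ forall q,
    induces_iso (cocycles C q) (coboundaries C q)
      (cocycles D q) (coboundaries D q) (f q).

Section DirectSum.
Variable M : nat -> lmodType K.

Definition gfamily : Type := forall q, M q.

HB.instance Definition _ := gen_eqMixin gfamily.
HB.instance Definition _ := gen_choiceMixin gfamily.

Fact gfamily_addA : associative (fun x y : gfamily => fun q => x q + y q).
Proof. by move=> x y z; apply: functional_extensionality_dep => q; rewrite addrA. Qed.
Fact gfamily_addC : commutative (fun x y : gfamily => fun q => x q + y q).
Proof. by move=> x y; apply: functional_extensionality_dep => q; rewrite addrC. Qed.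
Fact gfamily_add0 :
  left_id ((fun q => 0) : gfamily) (fun x y : gfamily => fun q => x q + y q).
Proof. by move=> x; apply: functional_extensionality_dep => q; rewrite add0r. Qed.
Fact gfamily_addN : left_inverse ((fun q => 0) : gfamily)
  (fun x => fun q => - x q) (fun x y : gfamily => fun q => x q + y q).
Proof. by move=> x; apply: functional_extensionality_dep => q; rewrite addNr. Qed.

HB.instance Definition _ := GRing.isZmodule.Build gfamily
  gfamily_addA gfamily_addC gfamily_add0 gfamily_addN.

Definition gfamily_scale (a : K) (x : gfamily) : gfamily := fun q => a *: x q.

Fact gfamily_scaleA a b x :
  gfamily_scale a (gfamily_scale b x) = gfamily_scale (a * b) x.
Proof. by apply: functional_extensionality_dep => q; exact: scalerA. Qed.
Fact gfamily_scale1 x : gfamily_scale 1 x = x.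
Proof. by apply: functional_extensionality_dep => q; exact: scale1r. Qed.
Fact gfamily_scaleDr a x y :
  gfamily_scale a (x + y) = gfamily_scale a x + gfamily_scale a y.
Proof. by apply: functional_extensionality_dep => q; exact: scalerDr. Qed.
Fact gfamily_scaleDl x a b :
  gfamily_scale (a + b) x = gfamily_scale a x + gfamily_scale b x.
Proof. by apply: functional_extensionality_dep => q; exact: scalerDl. Qed.

HB.instance Definition _ := GRing.Zmodule_isLmodule.Build K gfamily
  gfamily_scaleA gfamily_scale1 gfamily_scaleDr gfamily_scaleDl.

(* Finitely supported families (x_q in S_q) living in the degrees q whose
   parity is p (p = true: odd degrees). *)
Definition parity_sum_set (p : bool) (S : forall q, subspace (M q)) :
    set gfamily := fun x =>
  [/\ exists n, forall q, (n <= q)%N -> x q = 0,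
      forall q, odd q != p -> x q = 0 & forall q, x q \in S q].

Lemma parity_sum_subspace p S : subspace_set (parity_sum_set p S).
Proof.
split=> [|a u v [[n nu] pu Su] [[m mv] pv Sv]].
  by split=> [|//|q]; [exists 0%N | exact: rpred0].
have addE q : (a *: u + v) q = a *: u q + v q by [].
split=> [|q pq|q]; last by rewrite addE rpredD ?rpredZ ?Su ?Sv.
  exists (maxn n m) => q; rewrite geq_max => /andP[nq mq].
  by rewrite addE nu ?mv // scaler0 addr0.
by rewrite addE pu ?pv // scaler0 addr0.
Qed.

Definition parity_sum p S : subspace gfamily :=
  mk_subspace (parity_sum_subspace p S).

(* \bigoplus_(q = p mod 2) M q *)
Definition dsum (p : bool) : Type :=
  subm (parity_sum p (fun q => full_sub (M q))).
HB.instance Definition _ p := GRing.Lmodule.on (dsum p).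

Definition dsum_coord p (x : dsum p) (q : nat) : M q := subm_val x q.

End DirectSum.

End Cohomology.

Section HopfCyclic.
Variables (K : fieldType) (F : comAlgType K) (H : hopf F) (V : comodule H).

(* \sum phi (x_(1), ..., x_(n)); for n = 0 this is counit x *: phi (). *)
Fixpoint sweedler (N : lmodType K) n : ({ffun 'I_n -> F} -> N) -> F -> N :=
  match n with
  | 0 => fun phi x => counit H x *: phi [ffun=> 0]
  | n'.+1 => fun phi x =>
      \sw_(a, b <- comul H x) sweedler (fun s => phi (fins ord0 a s)) b
  end.

Local Notation C q := (mtens V F q).

(* Tensor factors are numbered from 0: the i-th coface, 0 < i <= q, applies
   comul to the factor of index k = i - 1. *)
Definition coface_fun q (i : 'I_q.+2) (v : V) (f : {ffun 'I_q -> F}) : C q.+1 :=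
  match unlift ord0 i with
  | None => mpure v (fins ord0 1 f)
  | Some j =>
    match unlift ord_max j with
    | Some k => \sw_(a, b <- comul H (f k))
                  mpure v (fins (lift ord0 k) b (fupd k a f))
    | None => \sw_(c, w <- coact V v) mpure w (fins ord_max c f)
    end
  end.

Definition coface q (i : 'I_q.+2) : C q -> C q.+1 := mlift (coface_fun i).

Definition codegen_fun q (j : 'I_q.+1) (v : V) (f : {ffun 'I_q.+1 -> F}) : C q :=
  counit H (f j) *: mpure v (fdel j f).

Definition codegen q (j : 'I_q.+1) : C q.+1 -> C q := mlift (codegen_fun j).

Definition cyc_fun q (v : V) (f : {ffun 'I_q.+1 -> F}) : C q.+1 :=
  \sw_(c, w <- coact V v)
    sweedler
      (fun s => mpure w [ffun i => s i * fins ord_max c (fdel ord0 f) i])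
      (antip H (f ord0)).

Definition cyc q : C q -> C q :=
  match q with
  | 0 => id
  | q'.+1 => mlift (@cyc_fun q')
  end.

Definition hoch_d q (x : C q) : C q.+1 :=
  \sum_(i < q.+2) (-1) ^+ i *: coface i x.

Definition connes q (x : C q.+1) : C q :=
  \sum_(i < q.+1) (-1) ^+ (q * i) *: iter i (@cyc q) (codegen ord_max (cyc x)).

Lemma eq_sweedler n (N : lmodType K) (phi psi : {ffun 'I_n -> F} -> N) x :
  (forall s, phi s = psi s) -> sweedler phi x = sweedler psi x.
Proof. by move=> eq_f; rewrite (_ : phi = psi) //; apply/funext. Qed.

Arguments cyc : simpl never.

Lemma sweedler_phi_linear n (N : lmodType K) a
    (phi psi : {ffun 'I_n -> F} -> N) x :
  sweedler (fun s => a *: phi s + psi s) x = a *: sweedler phi x + sweedler psi x.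
Proof.
elim: n phi psi x => [|n IHn] phi psi x /=; first by rewrite scalerDr !scalerA mulrC.
rewrite -tlift_phi_linear; apply: eq_tlift => ? ?.
  by rewrite IHn.
Qed.

Opaque fupd fins fdel.

Lemma sweedler_linear n (N : lmodType K) (phi : {ffun 'I_n -> F} -> N) :
  slotwise_linear phi -> linear (sweedler phi).
Proof.
elim: n phi => [|n IHn] phi phiP a x y /=.
  by rewrite linearP /= scalerDl scalerA.
rewrite (linearP (comul H)); apply: tlift_linear.
split=> [b c u v|u b c d] /=.
  rewrite -sweedler_phi_linear; apply: eq_sweedler => s.
  by apply: fins_linear.
by apply: IHn => i s e w z; rewrite !fins_upd phiP.
Qed.

Lemma coface_multilin q (i : 'I_q.+2) : multilin (coface_fun i).
Proof.
have mP n := mpure_multilin V F n.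
rewrite /coface_fun; case: (unlift ord0 i) => [j|]; last first.
  split=> [f a u v|v k f a x y]; first exact: (mP _).1.
  by rewrite !fins_upd (mP _).2.
case: (unlift ord_max j) => [k|]; split=> [f a u v|v m f a x y].
- rewrite -tlift_phi_linear; apply: eq_tlift => ? ?.
  by rewrite (mP _).1.
- have [->|mk] := eqVneq m k.
    have E z t : \sw_(c, d <- t) mpure v (fins (lift ord0 k) d (fupd k c (fupd k z f)))
        = \sw_(c, d <- t) mpure v (fins (lift ord0 k) d (fupd k c f)).
      apply: eq_tlift => ? ?.
  by rewrite fupd_upd.
    rewrite !fupd_same (linearP (comul H)).
    apply: etrans (E _ _) _; apply: etrans (etrans (tlift_linear _ _ _ _) _);
      last 1 first.
    - exact: (f_equal2 (fun s t => a *: s + t) (esym (E x _)) (esym (E y _))).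
    - by [].
    split=> [d|c]; first by move=> b u w; rewrite !fins_upd (mP _).2.
    by apply: (fins_linear _ (phi := fun s => mpure v s)); exact: (mP _).2.
  rewrite !(fupd_other _ _ (_ : k != m)) 1?eq_sym //.
  rewrite -tlift_phi_linear; apply: eq_tlift => ? ?.
  by rewrite !(fupdC _ _ _ (_ : k != m)) 1?eq_sym // !fins_upd (mP _).2.
- rewrite (linearP (coact V)); apply: tlift_linear; split=> [w|c]; last exact: (mP _).1.
  by apply: (fins_linear _ (phi := fun s => mpure w s)); exact: (mP _).2.
- rewrite -tlift_phi_linear; apply: eq_tlift => ? ?.
  by rewrite !fins_upd (mP _).2.
Qed.

Lemma codegen_multilin q (j : 'I_q.+1) : multilin (codegen_fun j).
Proof.
have mP n := mpure_multilin V F n.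
split=> [f a u v|v i f a x y]; rewrite /codegen_fun.
  by rewrite (mP _).1 scalerDr !scalerA mulrC.
case: (unliftP j i) => [i' ->|->].
  rewrite !(fupd_other _ _ (neq_lift _ _)) !fdel_upd (mP _).2.
  by rewrite scalerDr !scalerA mulrC.
by rewrite !fupd_same !fdel_upd_same (linearP (counit H)) /= scalerDl scalerA.
Qed.

Lemma cyc_multilin q : multilin (@cyc_fun q).
Proof.
have mP n := mpure_multilin V F n.
have mulP n (w : V) (g : {ffun 'I_n -> F}) :
    slotwise_linear (fun s => mpure w [ffun i => s i * g i]).
  move=> i s a x y.
  have E z : [ffun k => fupd i z s k * g k]
      = fupd i (z * g i) [ffun k => s k * g k].
    by apply/ffunP=> k; rewrite !ffunE; case: eqP => // ->.
  by rewrite !E mulrDl -scalerAl (mP _).2.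
have mulPr n (w : V) (s : {ffun 'I_n -> F}) :
    slotwise_linear (fun g => mpure w [ffun i => s i * g i]).
  move=> i g a x y.
  have E z : [ffun k => s k * fupd i z g k]
      = fupd i (s i * z) [ffun k => s k * g k].
    by apply/ffunP=> k; rewrite !ffunE; case: eqP => // ->.
  by rewrite !E mulrDr -scalerAr (mP _).2.
split=> [f a u v|v i f a x y]; rewrite /cyc_fun.
  rewrite (linearP (coact V)); apply: tlift_linear.
  split=> [w|c] b d e; cbv beta.
    rewrite -sweedler_phi_linear; apply: eq_sweedler => s.
    apply: (fins_linear _ (phi := fun r => mpure w [ffun i => s i * r i])).
    exact: mulPr.
  rewrite -sweedler_phi_linear; apply: eq_sweedler => s.
  by rewrite (mP _).1.
rewrite -tlift_phi_linear; apply: eq_tlift => ? ?.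
case: (unliftP ord0 i) => [i' ->|->].
  rewrite !(fupd_other _ _ (neq_lift _ _)) -sweedler_phi_linear; apply: eq_sweedler => s.
  by rewrite !fdel_upd !fins_upd mulPr.
rewrite !fupd_same !fdel_upd_same (linearP (antip H)); exact: sweedler_linear.
Qed.

Transparent fupd fins fdel.
Arguments sweedler : simpl never.

Lemma coface_is_linear q (i : 'I_q.+2) : linear (coface i).
Proof. exact: mlift_linear (coface_multilin i). Qed.
HB.instance Definition _ q (i : 'I_q.+2) :=
  GRing.isLinear.Build K (C q) (C q.+1) _ (coface i) (coface_is_linear i).

Lemma codegen_is_linear q (j : 'I_q.+1) : linear (codegen j).
Proof. exact: mlift_linear (codegen_multilin j). Qed.
HB.instance Definition _ q (j : 'I_q.+1) :=
  GRing.isLinear.Build K (C q.+1) (C q) _ (codegen j) (codegen_is_linear j).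

Lemma cyc_is_linear q : linear (@cyc q).
Proof. by case: q => [//|q]; exact: mlift_linear (@cyc_multilin q). Qed.
HB.instance Definition _ q :=
  GRing.isLinear.Build K (C q) (C q) _ (@cyc q) (@cyc_is_linear q).

Lemma hoch_d_is_linear q : linear (@hoch_d q).
Proof.
move=> a x y; rewrite /hoch_d scaler_sumr -big_split; apply: eq_bigr => i _ /=.
by rewrite (linearP (coface i)) scalerDr !scalerA mulrC.
Qed.
HB.instance Definition _ q :=
  GRing.isLinear.Build K (C q) (C q.+1) _ (@hoch_d q) (@hoch_d_is_linear q).

Lemma iter_cyc_linear q n : linear (iter n (@cyc q)).
Proof. by move=> a x y; elim: n => //= n ->; rewrite (linearP (@cyc q)). Qed.

Lemma connes_is_linear q : linear (@connes q).
Proof.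
move=> a x y; rewrite /connes scaler_sumr -big_split; apply: eq_bigr => i _ /=.
rewrite (linearP (@cyc q.+1)) (linearP (codegen ord_max)) /= iter_cyc_linear.
by rewrite scalerDr !scalerA mulrC.
Qed.
HB.instance Definition _ q :=
  GRing.isLinear.Build K (C q.+1) (C q) _ (@connes q) (@connes_is_linear q).

Definition hochschild : cochain_cpx K :=
  @CochainCpx K (fun q => C q) (fun q => full_sub _) (fun q => @hoch_d q).

Definition normalized_set q : set (C q) :=
  match q with
  | 0 => fun=> True
  | q'.+1 => fun x => forall j : 'I_q'.+1, codegen j x = 0
  end.

Lemma normalized_subspace q : subspace_set (@normalized_set q).
Proof.
case: q => [//|q]; split=> [j|a u v hu hv j]; first by rewrite raddf0.
by rewrite linearP /= hu hv scaler0 addr0.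
Qed.

Definition normalized q : subspace (C q) := mk_subspace (@normalized_subspace q).

(* b + B; connes is the Connes operator on normalized cochains only, so HP
   is computed from these. *)
Definition total_d (x : gfamily (fun q => C q)) : gfamily (fun q => C q) :=
  fun q => match q with
  | 0 => connes (x 1)
  | q'.+1 => hoch_d (x q') + connes (x q'.+2)
  end.

Lemma total_d_is_linear : linear total_d.
Proof.
move=> a x y; apply: functional_extensionality_dep => -[|q].
  exact: linearP.
have E (u v : gfamily (fun q => C q)) k : (a *: u + v) k = a *: u k + v k by [].
by rewrite E /total_d !E !linearP scalerDr addrACA.
Qed.
HB.instance Definition _ := GRing.isLinear.Build K
  (gfamily (fun q => C q)) (gfamily (fun q => C q)) _ total_d total_d_is_linear.

Definition periodic_cochains (p : bool) : subspace (gfamily (fun q => C q)) :=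
  parity_sum p normalized.

Definition periodic_cocycles p := ker_in (periodic_cochains p) total_d.
Definition periodic_coboundaries p := img_of (periodic_cochains (~~ p)) total_d.

Definition HP (p : bool) : lmodType K :=
  subquot (periodic_cocycles p) (periodic_coboundaries p).

End HopfCyclic.

Section Lie.
Variables (K : fieldType) (F : comAlgType K) (HF : hopf F) (g : lieAlg K)
  (U : enveloping g) (P : hopf_pairing HF (env_hopf U)).

Section Cochains.
Variable V : comodule HF.

(* The right action v X = <v_<-1>, X> v_<0>. *)
Definition ract (v : V) (X : g) : V :=
  \sw_(f, w <- coact V v) (P f (env_inj U X) *: w).

Definition cochain (q : nat) : Type := {ffun 'I_q -> g} -> V.
HB.instance Definition _ q := GRing.Lmodule.on (cochain q).

Definition alt_cochain q (phi : cochain q) : Prop :=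
  slotwise_linear phi /\
  forall (xi : {ffun 'I_q -> g}) i j, i != j -> xi i = xi j -> phi xi = 0.

(* The Chevalley-Eilenberg differential for the left action
   X v = - v X. *)
Definition ce_br q : cochain q -> cochain q.+1 :=
  match q with
  | 0 => fun=> 0
  | q'.+1 => fun phi xi =>
    \sum_(j < q'.+2) \sum_(i < q'.+1 | (i < j)%N)
      (-1) ^+ (i + j) *:
        phi (fins ord0 (lie_br (xi (lift j i)) (xi j)) (fdel i (fdel j xi)))
  end.

Definition ce_d q (phi : cochain q) : cochain q.+1 :=
  (fun xi : {ffun 'I_q.+1 -> g} =>
    \sum_(i < q.+1) (-1) ^+ i *: - ract (phi (fdel i xi)) (xi i)) + ce_br phi.

(* The left action of g on cochains. *)
Definition ce_act q (X : g) (phi : cochain q) : cochain q := fun xi =>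
  - ract (phi xi) X - \sum_(i < q) phi (fupd i (lie_br X (xi i)) xi).

Lemma ract_linear X : linear (ract^~ X).
Proof.
move=> a u v; rewrite /ract (linearP (coact V)); apply: tlift_linear.
split=> [w b x y|f b x y] /=; last by rewrite scalerDr !scalerA mulrC.
by rewrite pairing_linl scalerDl scalerA.
Qed.

Lemma ce_d_is_linear q : linear (@ce_d q).
Proof.
move=> a phi psi; apply: functional_extensionality_dep => xi.
pose f1 (phi : cochain q) := \sum_(i < q.+1)
  (-1) ^+ i *: - ract (phi (fdel i xi)) (xi i) : V.
suff [h1 h2] : f1 (a *: phi + psi) = a *: f1 phi + f1 psi /\
    ce_br (a *: phi + psi) xi = a *: ce_br phi xi + ce_br psi xi.
  by transitivity (f1 (a *: phi + psi) + ce_br (a *: phi + psi) xi) => //;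
     rewrite h1 h2 addrACA -scalerDr.
split.
  rewrite /f1 scaler_sumr -big_split; apply: eq_bigr => i _ /=.
  by rewrite ract_linear opprD -scalerN scalerDr !scalerA mulrC.
case: q phi psi xi {f1} => [|q] phi psi xi; first by rewrite scaler0 addr0.
rewrite /ce_br scaler_sumr -big_split; apply: eq_bigr => j _ /=.
rewrite scaler_sumr -big_split; apply: eq_bigr => i _ /=.
by rewrite scalerDr !scalerA mulrC.
Qed.
HB.instance Definition _ q :=
  GRing.isLinear.Build K (cochain q) (cochain q.+1) _ (@ce_d q)
    (@ce_d_is_linear q).

Section Relative.
Variables h l : {vspace g}.

(* V (x) /\^q (g/h)^*, as cochains on g; for g = h + l it is V (x) /\^q l^*,
   the restriction to l being inverted by composition with the projection
   onto l along h. *)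
Definition horizontal q (phi : cochain q) : Prop :=
  alt_cochain phi /\
  forall (xi : {ffun 'I_q -> g}) i, xi i \in h -> phi xi = 0.

Definition invariant q (phi : cochain q) : Prop :=
  forall X, X \in h -> ce_act X phi = 0.

Lemma ce_act_linear q X : linear (@ce_act q X).
Proof.
move=> a phi psi; apply: functional_extensionality_dep => xi.
transitivity (a *: ce_act X phi xi + ce_act X psi xi) => //; rewrite /ce_act.
have -> : \sum_(i < q) (a *: phi + psi) (fupd i (lie_br X (xi i)) xi)
    = a *: (\sum_(i < q) phi (fupd i (lie_br X (xi i)) xi))
      + \sum_(i < q) psi (fupd i (lie_br X (xi i)) xi).
  by rewrite scaler_sumr -big_split.
by rewrite ract_linear scalerBr scalerN !opprD addrACA.
Qed.

Lemma rel_cochains_subspace q :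
  subspace_set (fun phi : cochain q => horizontal phi /\ invariant phi).
Proof.
have E (a : K) (u v : cochain q) xi : (a *: u + v) xi = a *: u xi + v xi by [].
have act0 X : ce_act X (0 : cochain q) = 0.
  have := ce_act_linear X 1 (0 : cochain q) 0.
  by rewrite !scale1r addr0 => /eqP; rewrite -subr_eq0 opprD addrA subrr add0r
    oppr_eq0 => /eqP.
split=> [|a u v [[[lu au] hu] iu] [[[lv av] hv] iv]].
  have Z xi : (0 : cochain q) xi = 0 by [].
  split; last by move=> X _.
  by split=> [|xi i _]; first split=> [i xi b x y|xi i j _ _];
    rewrite !Z ?scaler0 ?addr0.
split; last by move=> X hX; rewrite ce_act_linear iu ?iv // scaler0 addr0.
split; last by move=> xi i hi; rewrite E (hu _ i) ?(hv _ i) // scaler0 addr0.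
split=> [i xi b x y|xi i j ij eij].
  rewrite !E lu lv !scalerDr !scalerA addrACA; congr (_ + _).
  by rewrite mulrC.
by rewrite E (au _ i j) ?(av _ i j) // scaler0 addr0.
Qed.

Definition rel_cochains q : subspace (cochain q) :=
  mk_subspace (@rel_cochains_subspace q).

Definition rel_cpx : cochain_cpx K :=
  @CochainCpx K cochain rel_cochains (fun q => @ce_d q).

(* H^q(g, h, V) *)
Definition rel_cohomology (q : nat) : lmodType K := cohomology rel_cpx q.

(* The h-equivariant projection of V (x) /\^q (g/h)^* onto its
   h-invariants; it is unique, and exists, when that h-module is a sum of
   finite dimensional semisimple ones. *)
Definition is_inv_proj q (pi : cochain q -> cochain q) : Prop :=
  [/\ forall (a : K) phi psi, horizontal phi -> horizontal psi ->
        pi (a *: phi + psi) = a *: pi phi + pi psi,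
      forall phi, horizontal phi -> horizontal (pi phi) /\ invariant (pi phi),
      forall phi, horizontal phi -> invariant phi -> pi phi = phi &
      forall X phi, X \in h -> horizontal phi ->
        pi (ce_act X phi) = ce_act X (pi phi)].

Definition inv_proj q : cochain q -> cochain q :=
  xget (fun=> 0) (@is_inv_proj q).

Definition antisym_fun q (v : V) (f : {ffun 'I_q -> F}) : cochain q := fun xi =>
  (\sum_(s : 'S_q) (-1) ^+ s *
     \prod_(i < q) P (f i) (env_inj U (daddv_pi l h (xi (s i))))) *: v.

Definition theta q (x : mtens V F q) : cochain q :=
  inv_proj (mlift (@antisym_fun q) x).

End Relative.
End Cochains.

Section Levi.
Variables h l : {vspace g}.

Definition semisimple_action (L W : vectType K) (act : L -> W -> W) : Prop :=
  forall W1 : {vspace W}, (forall x w, w \in W1 -> act x w \in W1) ->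
  exists W2 : {vspace W},
    [/\ forall x w, w \in W2 -> act x w \in W2,
        (W1 + W2 = fullv)%VS & (W1 :&: W2 = 0)%VS].

Definition sub_br (x y : subvs_of h) : subvs_of h :=
  vsproj h (lie_br (vsval x) (vsval y)).

Definition sub_rep (W : vectType K) (act : subvs_of h -> W -> W) : Prop :=
  [/\ forall w, linear (act^~ w), forall x, linear (act x) &
      forall x y w, act (sub_br x y) w = act x (act y w) - act y (act x w)].

Record levi_decomposition : Prop := LeviDecomposition {
  levi_subalg : forall x y, x \in h -> y \in h -> lie_br x y \in h;
  levi_ideal : forall x y, y \in l -> lie_br x y \in l;
  levi_sum : (h + l = fullv)%VS;
  levi_direct : (h :&: l = 0)%VS;
  levi_reductive : semisimple_action sub_br;
  levi_semisimple : forall (W : vectType K) (act : subvs_of h -> W -> W),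
    sub_rep act -> semisimple_action act;
  levi_theta : forall V : comodule HF,
    @quasi_iso K (hochschild V) (rel_cpx V h) (@theta V h l) }.

End Levi.
End Lie.

(* Main.v *)
(* A cochain v (x) f^1 (x) ... (x) f^q is read as a function of q points of the
   group Hom_alg(F, A), A a commutative algebra; it is determined by these
   functions, the tensor power of F carrying universal points.  In homogeneous
   coordinates, gam |-> c(gam_0 / gam_1, ..., gam_{q-1} / gam_q) . gam_q, cofaces
   delete, codegeneracies repeat and the cyclic operator rotates the arguments,
   so that the cocyclic identities become identities between maps of indices.
   They give the mixed complex (b, B) on normalized cochains and the fact that
   these compute Hochschild cohomology.  A primitive element pairs with F as a
   derivation at the counit, which forces theta B = 0 on normalized cochains.
   As theta is a quasi-isomorphism killing B, a b-cocycle of the form B z is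
   b-exact, and induction on the top degree of finitely supported cochains shows
   that theta is an isomorphism on the cohomology of b + B. *)
Require Import Defs.
From HB Require Import structures.
From mathcomp Require Import all_boot all_order all_algebra.
From mathcomp Require Import perm zify ring.
From mathcomp Require Import boolp monalg.
From mathcomp Require Import reals complex.

Set Implicit Arguments.
Unset Strict Implicit.
Unset Printing Implicit Defensive.

Import GRing.Theory.

Local Open Scope ring_scope.

(** * Linear maps and tensors *)

(** The vanishing of theta on the image of B takes place before antisymmetrization and projection.
    Evaluated at Lie algebra elements, the last codegeneracy after a rotation already produces the
    factor eps(S(f^1)) = 0, and every further rotation only permutes these elements up to sign. Two
    mismatches shape the rest. The Levi hypothesis concerns the full Hochschild complex, while
    periodic cohomology is defined by normalized cochains; hence normalization is proved for
    cochains whose coboundary is normalized, which covers both cocycles and primitives. Moreover the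
    projection inside theta is a mere choice, so the linearity of theta and its values in relative
    cochains are read off from the quasi-isomorphism. Finite support replaces a spectral sequence.
    For injectivity, subtracting (b + B) y removes the top component and disturbs only the one two
    degrees lower. For surjectivity, a cocycle is extended downwards by solving b y = - B z, and the
    next obstruction vanishes because B^2 = 0. *)

Section LinearMaps.
Variables (K : fieldType) (M N : lmodType K) (L : M -> N).
Hypothesis linL : linear L.

Lemma linear_fun0 : L 0 = 0.
Proof. by have := linL (-1) 0 0; rewrite scaler0 add0r scaleN1r addNr. Qed.

Lemma linear_funD x y : L (x + y) = L x + L y.
Proof. by have := linL 1 x y; rewrite !scale1r. Qed.

Lemma linear_funZ a x : L (a *: x) = a *: L x.
Proof. by have := linL a x 0; rewrite linear_fun0 !addr0. Qed.

Lemma linear_funN x : L (- x) = - L x.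
Proof. by rewrite -scaleN1r linear_funZ scaleN1r. Qed.

Lemma linear_funB x y : L (x - y) = L x - L y.
Proof. by rewrite linear_funD linear_funN. Qed.

Lemma linear_fun_sum I (r : seq I) (P : pred I) (E : I -> M) :
  L (\sum_(i <- r | P i) E i) = \sum_(i <- r | P i) L (E i).
Proof. exact: (big_morph L linear_funD linear_fun0). Qed.

End LinearMaps.

Lemma linear_comp (K : fieldType) (M N Q : lmodType K) (f : N -> Q) (g : M -> N) :
  linear f -> linear g -> linear (fun x => f (g x)).
Proof. by move=> lf lg a x y; rewrite lg lf. Qed.

Lemma linear_add (K : fieldType) (M N : lmodType K) (f g : M -> N) :
  linear f -> linear g -> linear (fun x => f x + g x).
Proof. by move=> lf lg a x y; rewrite lg lf scalerDr addrACA. Qed.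

Lemma linear_scale (K : fieldType) (M N : lmodType K) c (f : M -> N) :
  linear f -> linear (fun x => c *: f x).
Proof. by move=> lf a x y; rewrite lf scalerDr !scalerA mulrC. Qed.

Section FreeQuotientMaps.
Variables (K : fieldType) (X : choiceType) (rel : classical_sets.set {malg K[X]}).
Variables (M N : lmodType K).

Lemma lin_flift (L : M -> N) (lL : linear L) (phi : X -> M) (t : fquot rel) :
  L (flift phi t) = flift (fun x => L (phi x)) t.
Proof.
rewrite /flift /malg_lift (linear_fun_sum lL).
by apply: eq_bigr => x _; rewrite (linear_funZ lL).
Qed.

Lemma fquot_ext (L1 L2 : fquot rel -> N) : linear L1 -> linear L2 ->
  (forall x, L1 (fgen rel x) = L2 (fgen rel x)) -> L1 =1 L2.
Proof.
move=> l1 l2 e t; rewrite -(qpiK t) (monalgE (repr t)).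
rewrite (linear_fun_sum (@qpi_is_linear K _ (Defs.span rel))).
rewrite (linear_fun_sum l1) (linear_fun_sum l2); apply: eq_bigr => x _.
have -> : qpi (Defs.span rel) << (repr t)@_x *g x >> = (repr t)@_x *: fgen rel x.
  have -> : << (repr t)@_x *g x >> = (repr t)@_x *: << x >> :> {malg K[X]}.
    by apply/malgP => y; rewrite mcoeffZ !mcoeffU mulr_natr.
  exact: (linear_funZ (@qpi_is_linear K _ (Defs.span rel))).
by rewrite (linear_funZ l1) (linear_funZ l2) e.
Qed.

End FreeQuotientMaps.

Section TensorMaps.
Variables (K : fieldType) (V W N : lmodType K).

Lemma lin_tlift (Q : lmodType K) (L : N -> Q) (lL : linear L)
    (phi : V -> W -> N) (t : tens V W) :
  L (tlift phi t) = tlift (fun v w => L (phi v w)) t.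
Proof. exact: (lin_flift lL). Qed.

Lemma tens_ext (L1 L2 : tens V W -> N) : linear L1 -> linear L2 ->
  (forall v w, L1 (tpure v w) = L2 (tpure v w)) -> L1 =1 L2.
Proof. by move=> l1 l2 e; apply: fquot_ext => // -[v w]; exact: e. Qed.

End TensorMaps.

Section MultiTensorMaps.
Variables (K : fieldType) (V F N : lmodType K) (q : nat).

Lemma lin_mlift (Q : lmodType K) (L : N -> Q) (lL : linear L)
    (phi : V -> {ffun 'I_q -> F} -> N) (t : mtens V F q) :
  L (mlift phi t) = mlift (fun v f => L (phi v f)) t.
Proof. exact: (lin_flift lL). Qed.

Lemma mtens_ext (L1 L2 : mtens V F q -> N) : linear L1 -> linear L2 ->
  (forall v f, L1 (mpure v f) = L2 (mpure v f)) -> L1 =1 L2.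
Proof. by move=> l1 l2 e; apply: fquot_ext => // -[v w]; exact: e. Qed.

Lemma eq_mlift (phi psi : V -> {ffun 'I_q -> F} -> N) (t : mtens V F q) :
  (forall v f, phi v f = psi v f) -> mlift phi t = mlift psi t.
Proof. by move=> e; congr (mlift _ t); apply/funext => v; apply/funext. Qed.

Lemma mlift_phi_linear a (phi psi : V -> {ffun 'I_q -> F} -> N) (t : mtens V F q) :
  mlift (fun v f => a *: phi v f + psi v f) t = a *: mlift phi t + mlift psi t.
Proof. exact: flift_phi_linear. Qed.

End MultiTensorMaps.

Section Sweedler.
Variables (K : fieldType) (F : comAlgType K) (H : hopf F) (N Q : lmodType K).

Lemma lin_sweedler (L : N -> Q) (lL : linear L) n (phi : {ffun 'I_n -> F} -> N) x :
  L (sweedler H phi x) = sweedler H (fun s => L (phi s)) x.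
Proof.
elim: n phi x => [|n IHn] phi x /=; first by rewrite (linear_funZ lL).
by rewrite (lin_tlift lL); apply: eq_tlift => a b; rewrite IHn.
Qed.

End Sweedler.

(** * Hopf algebra identities *)

Section Trilinear.
Variable K : fieldType.

Definition trilin (M N P Q : lmodType K) (phi : M -> N -> P -> Q) : Prop :=
  [/\ forall y z, linear (fun x => phi x y z),
      forall x z, linear (fun y => phi x y z) &
      forall x y, linear (phi x y)].

Lemma tlift_tlift_bilin (M N P Q : lmodType K) (phi : M -> N -> P -> Q) :
  trilin phi -> bilin (fun t z => tlift (fun x y => phi x y z) t).
Proof.
case=> p1 p2 p3; split=> [z|t]; first by apply: tlift_linear; split.
move=> a z z'; rewrite -tlift_phi_linear; apply: eq_tlift => x y; exact: p3.
Qed.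

Lemma trilin_lift (M N P Q : lmodType K) (phi : M -> N -> P -> Q) :
  trilin phi -> exists2 L : tens (Defs_tens__canonical__GRing_Lmodule M N) P -> Q, linear L &
    forall x y z, L (tpure (tpure x y) z) = phi x y z.
Proof.
move=> phiP; have bphi := tlift_tlift_bilin phiP.
exists (tlift (fun t z => tlift (fun x y => phi x y z) t)).
  exact: tlift_linear.
by move=> x y z; rewrite !tlift_pure //; case: phiP.
Qed.

(** Taking [rho] to be a coaction or the coproduct itself, this turns both [coactA] and [comulA]
    into identities for arbitrary trilinear functions. *)
Lemma trilin_coassoc (C V N : lmodType K) (D : C -> tens C C) (rho : V -> tens C V)
    (phi : C -> C -> V -> N) v :
  \sw_(f, w <- rho v) \sw_(f', f'' <- D f) tpure (tpure f' f'') w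
  = \sw_(f, w <- rho v) \sw_(f', w' <- rho w) tpure (tpure f f') w' ->
  trilin phi ->
  \sw_(f, w <- rho v) \sw_(f', f'' <- D f) phi f' f'' w
  = \sw_(f, w <- rho v) \sw_(f', w' <- rho w) phi f f' w'.
Proof.
move=> e /trilin_lift[L lL LE].
have {e} := etrans (esym (lin_tlift lL _ _)) (etrans (congr1 L e) (lin_tlift lL _ _)).
move=> e; apply: etrans (etrans e _); apply: eq_tlift => a b.
  by apply: etrans (esym (lin_tlift lL _ _)); apply: eq_tlift => a' a''.
by apply: etrans (lin_tlift lL _ _) _; apply: eq_tlift => a' a''.
Qed.

End Trilinear.

Section HopfAlgebra.
Variables (K : fieldType) (F : comAlgType K) (H : hopf F).

Lemma comul_coassoc (N : lmodType K) (phi : F -> F -> F -> N) f : trilin phi ->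
  \sw_(a, b <- comul H f) \sw_(a', a'' <- comul H a) phi a' a'' b
  = \sw_(a, b <- comul H f) \sw_(b', b'' <- comul H b) phi a b' b''.
Proof. by move=> phiP; exact: (trilin_coassoc (comulA H f) phiP). Qed.

Lemma coact_coassoc (V : comodule H) (N : lmodType K) (phi : F -> F -> V -> N) v :
  trilin phi ->
  \sw_(f, w <- coact V v) \sw_(f', f'' <- comul H f) phi f' f'' w
  = \sw_(f, w <- coact V v) \sw_(f', w' <- coact V w) phi f f' w'.
Proof. by move=> phiP; exact: (trilin_coassoc (coactA v) phiP). Qed.

Lemma linear_comul (N : lmodType K) (phi : F -> F -> N) :
  bilin phi -> linear (fun f => \sw_(a, b <- comul H f) phi a b).
Proof. by move=> bphi; apply: linear_comp (tlift_linear bphi) (linearP _). Qed.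

Lemma linear_coact (V : comodule H) (N : lmodType K) (phi : F -> V -> N) :
  bilin phi -> linear (fun v => \sw_(c, w <- coact V v) phi c w).
Proof. by move=> bphi; apply: linear_comp (tlift_linear bphi) (linearP _). Qed.

Lemma linear_mulr (A : comAlgType K) (c : A) : linear (fun x => x * c).
Proof. by move=> a x y; rewrite mulrDl scalerAl. Qed.

Lemma linear_mull (A : comAlgType K) (c : A) : linear (fun x => c * x).
Proof. by move=> a x y; rewrite mulrDr scalerAr. Qed.

Lemma bilin_mul (A : comAlgType K) (M N : lmodType K) (u : M -> A) (w : N -> A) :
  linear u -> linear w -> bilin (fun x y => u x * w y).
Proof.
move=> lu lw; split=> [y|x]; first exact: linear_comp (linear_mulr _) lu.
exact: linear_comp (linear_mull _) lw.
Qed.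

Lemma trilin_mul (A : comAlgType K) (M N P : lmodType K)
    (u : M -> A) (w : N -> A) (z : P -> A) :
  linear u -> linear w -> linear z -> trilin (fun x y t => u x * w y * z t).
Proof.
move=> lu lw lz; split=> [y t|x t|x y].
- apply: linear_comp (linear_mulr _) _; exact: linear_comp (linear_mulr _) lu.
- apply: linear_comp (linear_mulr _) _; exact: linear_comp (linear_mull _) lw.
- exact: linear_comp (linear_mull _) lz.
Qed.

Lemma sw_mulr (A : comAlgType K) (M N : lmodType K) (phi : M -> N -> A) t c :
  tlift phi t * c = tlift (fun x y => phi x y * c) t.
Proof. exact: (lin_tlift (@linear_mulr A c)). Qed.

Lemma sw_mull (A : comAlgType K) (M N : lmodType K) (phi : M -> N -> A) t c :
  c * tlift phi t = tlift (fun x y => c * phi x y) t.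
Proof. exact: (lin_tlift (@linear_mull A c)). Qed.

Lemma antip_linear : linear (antip H). Proof. exact: linearP. Qed.

Lemma id_linear (M : lmodType K) : linear (fun x : M => x).
Proof. by []. Qed.

Lemma conv_counitr (N : lmodType K) (u : F -> N) f : linear u ->
  \sw_(a, b <- comul H f) (counit H b *: u a) = u f.
Proof.
move=> lu; rewrite -[in RHS](counitr H f) (lin_tlift lu).
by apply: eq_tlift => a b; rewrite (linear_funZ lu).
Qed.

Lemma conv_counitl (N : lmodType K) (u : F -> N) f : linear u ->
  \sw_(a, b <- comul H f) (counit H a *: u b) = u f.
Proof.
move=> lu; rewrite -[in RHS](counitl H f) (lin_tlift lu).
by apply: eq_tlift => a b; rewrite (linear_funZ lu).
Qed.

(** Convolve with the antipode on the right: u = u * id * S, and u * id is c times the counit, so u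
    = c S. *)
Lemma antip_unique (u : F -> F) (c : F) : linear u ->
    (forall f, \sw_(a, b <- comul H f) (u a * b) = counit H f *: c) ->
  forall f, u f = c * antip H f.
Proof.
move=> lu uP f; rewrite -(conv_counitr f lu).
have E a b : counit H b *: u a
    = \sw_(b', b'' <- comul H b) (u a * b' * antip H b'').
  rewrite -[LHS]mulr_algr -(antipr H b) sw_mull.
  by apply: eq_tlift => ? ?; rewrite mulrA.
under eq_tlift do rewrite E.
rewrite -comul_coassoc; last exact: trilin_mul lu (@id_linear _) antip_linear.
under eq_tlift do rewrite -sw_mulr uP -scalerAl.
exact: (conv_counitl _ (linear_comp (@linear_mull _ c) antip_linear)).
Qed.

Lemma antip1 : antip H 1 = 1.
Proof.
have := antipl H 1; rewrite comul1 tlift_pure; last exact: bilin_mul antip_linear (@id_linear _).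
by rewrite mulr1 counit1 scale1r.
Qed.

Lemma tens_mul_sw (N : lmodType K) (phi : F -> F -> N) f g : bilin phi ->
  \sw_(x, y <- comul H (f * g)) phi x y
  = \sw_(a, b <- comul H f) \sw_(c, d <- comul H g) phi (a * c) (b * d).
Proof.
move=> bphi; have lphi := tlift_linear bphi.
rewrite comulM /tens_mul (lin_tlift lphi); apply: eq_tlift => a b.
by rewrite (lin_tlift lphi); apply: eq_tlift => c d; rewrite tlift_pure.
Qed.

Lemma antipM f g : antip H (f * g) = antip H f * antip H g.
Proof.
(* Uniqueness of the convolution inverse, applied in each variable in turn. *)
have step (x y : F) :
    \sw_(c, d <- comul H y) (antip H (x * c) * d) = counit H y *: antip H x.
  rewrite -[RHS]mulr_algl.
  pose u z := \sw_(c, d <- comul H y) (antip H (z * c) * d).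
  apply: (antip_unique (u := u)) => [a z z'|z].
    rewrite /u -tlift_phi_linear; apply: eq_tlift => c d.
    by rewrite mulrDl linearD /= -scalerAl linearZ /= mulrDl -scalerAl.
  have bphi : bilin (fun a b => antip H a * b) by exact: bilin_mul antip_linear (@id_linear _).
  transitivity ((counit H (z * y))%:A : F); last by rewrite counitM -scalerA.
  rewrite -(antipl H (z * y)) (tens_mul_sw _ _ bphi).
  apply: eq_tlift => a b; rewrite /u sw_mulr; apply: eq_tlift => c d.
  by rewrite -mulrA (mulrC d).
pose w z := antip H (f * z).
apply: (antip_unique (u := w)) => [a z z'|z]; last exact: step.
by rewrite /w mulrDr -scalerAr linearP.
Qed.

(** Apply the counit to the axiom S(f_(1)) f_(2) = eps(f) 1 and absorb eps(f_(2)). *)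
Lemma counit_antip f : counit H (antip H f) = counit H f.
Proof.
have lin : linear (counit H : F -> K^o) by exact: linearP.
have := congr1 (counit H : F -> K^o) (antipl H f).
rewrite (lin_tlift lin) (linear_funZ lin) counit1 [_ *: _]mulr1 => <-.
rewrite -[LHS](@conv_counitr K^o (fun a => counit H (antip H a)) f); last first.
  exact: linear_comp lin antip_linear.
by apply: (@eq_tlift _ _ _ K^o) => a b; rewrite counitM mulrC.
Qed.

End HopfAlgebra.

(** * The group of points of a commutative Hopf algebra *)

Record point (K : fieldType) (F : comAlgType K) (H : hopf F) (A : comAlgType K) :=
  Point {
    point_fun :> F -> A;
    point_linear : linear point_fun;
    point1 : point_fun 1 = 1;
    pointM : forall f g, point_fun (f * g) = point_fun f * point_fun g }.

Section Points.
Variables (K : fieldType) (F : comAlgType K) (H : hopf F) (A : comAlgType K).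
Local Notation point := (point H A).

Lemma point_ext (g h : point) : (forall f, g f = h f) -> g = h.
Proof.
case: g h => [g lg g1 gM] [h lh h1 hM] /= /funext e; case: _ / e lh h1 hM => lh h1 hM.
by congr Point; exact: Prop_irrelevance.
Qed.

HB.instance Definition _ := gen_eqMixin point.
HB.instance Definition _ := gen_choiceMixin point.

Definition pt_mul_fun (g h : point) (f : F) : A := \sw_(a, b <- comul H f) (g a * h b).

Lemma pt_mul_bilin (g h : point) : bilin (fun a b => g a * h b).
Proof. exact: bilin_mul (point_linear g) (point_linear h). Qed.

Lemma pt_mul_linear g h : linear (pt_mul_fun g h).
Proof. exact: linear_comul (pt_mul_bilin g h). Qed.

Lemma pt_mul1 g h : pt_mul_fun g h 1 = 1.
Proof.
by rewrite /pt_mul_fun comul1 tlift_pure ?point1 ?mulr1 //; exact: pt_mul_bilin.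
Qed.

Lemma pt_mulM g h x y : pt_mul_fun g h (x * y) = pt_mul_fun g h x * pt_mul_fun g h y.
Proof.
rewrite /pt_mul_fun (tens_mul_sw _ _ _ (pt_mul_bilin g h)) sw_mulr.
apply: eq_tlift => a b; rewrite sw_mull; apply: eq_tlift => c d.
by rewrite !pointM mulrACA.
Qed.

Definition pt_mul g h : point := Point H (pt_mul_linear g h) (pt_mul1 g h) (pt_mulM g h).

Lemma pt_one_linear : linear (fun f => (counit H f)%:A : A).
Proof. by move=> a x y; rewrite linearP /= scalerDl scalerA. Qed.

Lemma pt_one1 : (counit H 1)%:A = 1 :> A.
Proof. by rewrite counit1 scale1r. Qed.

Lemma pt_oneM x y : (counit H (x * y))%:A = (counit H x)%:A * (counit H y)%:A :> A.
Proof. by rewrite counitM mulr_algl scalerA. Qed.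

Definition pt_one : point := Point H pt_one_linear pt_one1 pt_oneM.

Lemma pt_inv_linear (g : point) : linear (fun f => g (antip H f)).
Proof. exact: linear_comp (point_linear g) (antip_linear H). Qed.

Lemma pt_inv1 (g : point) : g (antip H 1) = 1.
Proof. by rewrite antip1 point1. Qed.

Lemma pt_invM (g : point) x y : g (antip H (x * y)) = g (antip H x) * g (antip H y).
Proof. by rewrite antipM pointM. Qed.

Definition pt_inv g : point := Point H (pt_inv_linear g) (pt_inv1 g) (pt_invM g).

Lemma pt_mulA : associative pt_mul.
Proof.
move=> g h k; apply: point_ext => f; apply/esym.
pose phi (x y z : F) := g x * h y * k z.
have phiP : trilin phi.
  exact: trilin_mul (point_linear g) (point_linear h) (point_linear k).
apply: etrans (etrans (comul_coassoc H f phiP) _); apply: eq_tlift => a b.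
  by rewrite /= /pt_mul_fun sw_mulr.
by rewrite /= /pt_mul_fun sw_mull; apply: eq_tlift => c d; rewrite /phi mulrA.
Qed.

Lemma pt_mul1g : left_id pt_one pt_mul.
Proof.
move=> g; apply: point_ext => f; rewrite -[RHS](conv_counitl H f (point_linear g)).
by apply: eq_tlift => a b; rewrite /= mulr_algl.
Qed.

Lemma pt_mulg1 : right_id pt_one pt_mul.
Proof.
move=> g; apply: point_ext => f; rewrite -[RHS](conv_counitr H f (point_linear g)).
by apply: eq_tlift => a b; rewrite /= mulr_algr.
Qed.

Lemma point_alg (g : point) c : g c%:A = c%:A.
Proof. by rewrite (linear_funZ (point_linear g)) point1. Qed.

Lemma pt_mulVg : left_inverse pt_one pt_inv pt_mul.
Proof.
move=> g; apply: point_ext => f; rewrite /= -(point_alg g) -(antipl H).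
rewrite (lin_tlift (point_linear g)); apply: eq_tlift => a b.
by rewrite /= pointM.
Qed.

Lemma pt_mulgV : right_inverse pt_one pt_inv pt_mul.
Proof.
move=> g; apply: point_ext => f; rewrite /= -(point_alg g) -(antipr H).
rewrite (lin_tlift (point_linear g)); apply: eq_tlift => a b.
by rewrite /= pointM.
Qed.

HB.instance Definition _ := isGroup.Build point pt_mulA pt_mul1g pt_mulg1 pt_mulVg pt_mulgV.

Lemma point_mulE (g h : point) f :
  (g * h)%g f = \sw_(a, b <- comul H f) (g a * h b).
Proof. by []. Qed.

Lemma point_oneE f : (1%g : point) f = (counit H f)%:A.
Proof. by []. Qed.

Lemma point_invE (g : point) f : g^-1%g f = g (antip H f).
Proof. by []. Qed.

End Points.

(** * Cochains as functions of points *)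

Lemma mul_divg (G : groupType) (a b c : G) : (a / b * (b / c) = a / c)%g.
Proof. by rewrite mulgA mulgVK. Qed.

Lemma bumpS_neq i j : j.+1 != i -> (bump i j).+1 = bump i j.+1.
Proof. by rewrite /bump (leq_eqVlt i j.+1) eq_sym => /negPf->; rewrite ltnS addnS. Qed.

Lemma unbump_bumpS i j : unbump i (bump i j).+1 = j.+1.
Proof.
rewrite /unbump /bump; case: (leqP i j) => ij; first by rewrite !ltnS leqW ?subn1.
by rewrite add0n ltnS leqNgt ij subn0.
Qed.

Lemma prodD1 (R : comPzSemiRingType) q (k : 'I_q) (e : 'I_q -> R) :
  \prod_(j < q) e j = e k * \prod_(j < q | j != k) e j.
Proof. exact: bigD1. Qed.

Lemma prodD1_ord (R : comPzSemiRingType) q (k : 'I_q.+1) (e : 'I_q.+1 -> R) :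
  \prod_(j < q.+1) e j = e k * \prod_(j < q) e (lift k j).
Proof. exact: bigD1_ord. Qed.

Lemma prod_fupd (R : comPzSemiRingType) (T : Type) q (e : 'I_q -> T -> R) k x
    (f : {ffun 'I_q -> T}) :
  \prod_(j < q) e j (fupd k x f j) = e k x * \prod_(j < q | j != k) e j (f j).
Proof.
rewrite (prodD1 k) fupd_same; congr (_ * _); apply: eq_bigr => j jk.
by rewrite fupd_other.
Qed.

Section Evaluation.
Variables (K : fieldType) (F : comAlgType K) (H : hopf F) (V : comodule H).
Variable A : comAlgType K.
Local Notation point := (point H A).
Local Notation C q := (mtens V F q).
Implicit Types (g h : point) (gam : nat -> point).

Lemma tpure_linearl (M N : lmodType K) (y : N) : linear (fun x : M => tpure x y).
Proof. exact: (tpure_bilin M N).1. Qed.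

Lemma tpure_linearr (M N : lmodType K) (x : M) : linear (tpure x : N -> _).
Proof. exact: (tpure_bilin M N).2. Qed.

(** A left coaction makes points act on the right, whence the order of the factors in [pt_actM]. *)
Definition pt_act_fun g (v : V) (a : A) : tens V A :=
  \sw_(c, w <- coact V v) tpure w (g c * a).

Lemma pt_act_trilin g : trilin (fun (c : F) (w : V) (a : A) => tpure w (g c * a)).
Proof.
split=> [w a|c a|c w].
- apply: linear_comp (@tpure_linearr V A w) _.
  exact: linear_comp (@linear_mulr K A a) (point_linear g).
- exact: tpure_linearl.
- exact: linear_comp (@tpure_linearr V A w) (@linear_mull K A (g c)).
Qed.

Lemma pt_act_bilin g : bilin (pt_act_fun g).
Proof.
have [h1 h2 h3] := pt_act_trilin g; split=> [a|v].
  by apply: linear_coact; split.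
move=> b a a'; rewrite /pt_act_fun -tlift_phi_linear; apply: eq_tlift => c w.
exact: h3.
Qed.

Definition pt_act g : tens V A -> tens V A := tlift (pt_act_fun g).

Lemma pt_act_linear g : linear (pt_act g).
Proof. exact: tlift_linear (pt_act_bilin g). Qed.

Lemma pt_act_pure g v a : pt_act g (tpure v a) = \sw_(c, w <- coact V v) tpure w (g c * a).
Proof. exact: tlift_pure (pt_act_bilin g) _ _. Qed.

Lemma pt_actM g h t : pt_act (g * h)%g t = pt_act h (pt_act g t).
Proof.
move: t; apply: tens_ext => [||v a]; first exact: pt_act_linear.
  exact: linear_comp (pt_act_linear h) (pt_act_linear g).
pose phi (c d : F) (w : V) := tpure w (g c * h d * a) : tens V A.
have phiP : trilin phi.
  split=> [d w|c w|c d]; last exact: tpure_linearl.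
    apply: linear_comp (@tpure_linearr V A w) _; apply: linear_comp (@linear_mulr K A a) _.
    exact: linear_comp (@linear_mulr K A _) (point_linear g).
  apply: linear_comp (@tpure_linearr V A w) _; apply: linear_comp (@linear_mulr K A a) _.
  exact: linear_comp (@linear_mull K A _) (point_linear h).
rewrite !pt_act_pure (lin_tlift (pt_act_linear h)).
apply: etrans (etrans (coact_coassoc v phiP) _); apply: eq_tlift => c w.
  by rewrite point_mulE sw_mulr (lin_tlift (@tpure_linearr V A w)).
by rewrite pt_act_pure; apply: eq_tlift => d w'; rewrite /phi mulrCA mulrA.
Qed.

Lemma pt_act1 t : pt_act 1%g t = t.
Proof.
move: t; apply: tens_ext => [||v a] //; first exact: pt_act_linear.
rewrite pt_act_pure -[in RHS](coact1 v) (lin_tlift (@tpure_linearl V A a)).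
apply: eq_tlift => c w; rewrite mulr_algl.
by rewrite (linear_funZ (@tpure_linearl V A a)) (linear_funZ (@tpure_linearr V A w)).
Qed.

(** Points are indexed by [nat] so that reindexing along [bump], [unbump] and [cycidx] requires no
    cast between ordinals. *)
Definition ev_fun q (gam : nat -> point) (v : V) (f : {ffun 'I_q -> F}) : tens V A :=
  tpure v (\prod_(i < q) gam i (f i)).

Lemma ev_multilin q gam : multilin (@ev_fun q gam).
Proof.
split=> [f|v i f]; first exact: tpure_linearl.
apply: linear_comp (@tpure_linearr V A v) _.
have E x : \prod_(j < q) gam j (fupd i x f j)
    = gam i x * \prod_(j < q | j != i) gam j (f j) := prod_fupd (fun j => gam j : F -> A) i x f.
by move=> a x y; rewrite !E (point_linear (gam i)) mulrDl scalerAl.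
Qed.

Definition ev q gam : C q -> tens V A := mlift (@ev_fun q gam).

Lemma ev_linear q gam : linear (@ev q gam).
Proof. exact: mlift_linear (ev_multilin _ gam). Qed.

Lemma ev_pure q gam v (f : {ffun 'I_q -> F}) :
  ev gam (mpure v f) = tpure v (\prod_(i < q) gam i (f i)).
Proof. exact: mlift_pure (ev_multilin _ gam) _ _. Qed.

Definition homog q (t : C q) gam : tens V A :=
  pt_act (gam q) (ev (fun i => gam i / gam i.+1)%g t).

Lemma homog_linear q gam : linear (fun t : C q => homog t gam).
Proof. by move=> a x y; rewrite /homog ev_linear pt_act_linear. Qed.

Lemma homog_pure q gam v (f : {ffun 'I_q -> F}) :
  homog (mpure v f) gam
  = pt_act (gam q) (tpure v (\prod_(i < q) (gam i / gam i.+1)%g (f i))).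
Proof. by rewrite /homog ev_pure. Qed.

Lemma prod_fins gam q (i : 'I_q.+1) x (f : {ffun 'I_q -> F}) :
  \prod_(j < q.+1) gam j (fins i x f j)
  = gam i x * \prod_(j < q) gam (bump i j) (f j).
Proof.
rewrite (prodD1_ord i) ffunE unlift_none /=; congr (_ * _).
by apply: eq_bigr => j _; rewrite ffunE liftK.
Qed.

Lemma bump_small i j : (j < i)%N -> bump i j = j.
Proof. by move=> ji; rewrite /bump leqNgt ji. Qed.

Lemma bump_big i j : (i <= j)%N -> bump i j = j.+1.
Proof. by move=> ij; rewrite /bump ij. Qed.

(** Face 0 evaluates a quotient of points at 1. An inner face multiplies two consecutive quotients,
    and the middle point cancels. The last face lets gam_q / gam_{q+1} act before gam_{q+1}, which
    together is the action of gam_q. *)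
Lemma homog_coface q (i : 'I_q.+2) (t : C q) gam :
  homog (coface i t) gam = homog t (fun j => gam (bump i j)).
Proof.
move: t; apply: mtens_ext => [||v f].
- exact: linear_comp (homog_linear gam) (@coface_is_linear _ _ H V _ i).
- exact: homog_linear.
rewrite /coface mlift_pure; last exact: coface_multilin.
(* The copy [n] of the index keeps the reindexing on the right untouched while [i] is analysed on
   the left. *)
rewrite homog_pure /coface_fun; have [n ni] : exists n, n = i :> nat by exists i.
rewrite -ni; case: (unliftP ord0 i) ni => [j ->|->] ni; last first.
  rewrite homog_pure (prod_fins (fun i => gam i / gam i.+1)%g) point1 mul1r.
  by rewrite ni /bump /=.
case: (unliftP ord_max j) ni => [k ->|->] ni.
  rewrite (lin_tlift (homog_linear gam)).
  have {}ni : n = k.+1 by rewrite ni lift0 lift_max.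
  rewrite ni; rewrite [in RHS]bump_big; last exact: ltn_ord.
  have lin1 : linear (fun x => pt_act (gam q.+1) (tpure v x)).
    exact: linear_comp (pt_act_linear _) (@tpure_linearr V A v).
  pose r := \prod_(j < q | j != k) (gam (bump k.+1 j) / gam (bump k.+1 j.+1))%g (f j).
  transitivity (\sw_(a, b <- comul H (f k)) pt_act (gam q.+1)
      (tpure v ((gam k / gam k.+1)%g a * (gam k.+1 / gam k.+2)%g b * r))).
    apply: eq_tlift => a b; rewrite homog_pure (prod_fins (fun i => gam i / gam i.+1)%g) /= -[bump 0 k]/k.+1.
    rewrite (prod_fupd (fun j : 'I_q => (gam (bump k.+1 j) / gam (bump k.+1 j).+1)%g : F -> A)).
    rewrite (bump_small (ltnSn k)) mulrCA mulrA.
    congr (pt_act _ (tpure _ (_ * _))); apply: eq_bigr => m mk.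
    by congr ((_ / gam _)%g (f m)); rewrite bumpS_neq.
  apply: etrans (esym (lin_tlift lin1 _ _)) _; congr (pt_act _ (tpure _ _)).
  rewrite -sw_mulr -point_mulE (prodD1 k) bump_small // bump_big //.
  by rewrite mul_divg.
rewrite (lin_tlift (homog_linear gam)).
transitivity (pt_act (gam q.+1) (pt_act (gam q / gam q.+1)%g
    (tpure v (\prod_(j < q) (gam j / gam j.+1)%g (f j))))).
  rewrite [in RHS]pt_act_pure (lin_tlift (pt_act_linear _)); apply: eq_tlift => c w.
  rewrite homog_pure (prod_fins (fun i => gam i / gam i.+1)%g) /=; congr (pt_act _ (tpure _ (_ * _))).
  by apply: eq_bigr => m _; rewrite bump_small.
rewrite -pt_actM mulgVK; have {}ni : n = q.+1 by rewrite ni lift0.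
rewrite ni (bump_small (ltnSn q)).
congr (pt_act _ (tpure _ _)); apply: eq_bigr => m _.
by rewrite (bump_small (leqW (ltn_ord m))) (bump_small (ltn_ord m : (m.+1 < q.+1)%N)).
Qed.

(** With a repeated argument the quotient of points in slot j is the unit of the group, whose value
    is the counit. *)
Lemma homog_codegen q (j : 'I_q.+1) (t : C q.+1) gam :
  homog (codegen j t) gam = homog t (fun k => gam (unbump j k)).
Proof.
move: t; apply: mtens_ext => [||v f].
- exact: linear_comp (homog_linear gam) (@codegen_is_linear _ _ H V _ j).
- exact: homog_linear.
rewrite /codegen mlift_pure; last exact: codegen_multilin.
rewrite (linear_funZ (homog_linear gam)) !homog_pure.
have -> : unbump j q.+1 = q by rewrite /unbump ltn_ord subn1.
rewrite (prodD1_ord j) [unbump j j]/unbump ltnn subn0.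
have -> : unbump j j.+1 = j by rewrite /unbump ltnSn subn1.
rewrite mulgV point_oneE mulr_algl.
rewrite (linear_funZ (@tpure_linearr V A v)) (linear_funZ (pt_act_linear _)).
congr (_ *: pt_act _ (tpure _ _)); apply: eq_bigr => i _; rewrite ffunE.
congr ((gam _ / gam _)%g _); first by rewrite bumpK.
exact/esym/unbump_bumpS.
Qed.

Lemma sweedler_prod n gam x :
  sweedler H (fun s => \prod_(i < n) gam i (s i)) x = (\prod_(i < n) gam i)%g x.
Proof.
elim: n gam x => [|n IHn] gam x /=; first by rewrite !big_ord0 point_oneE.
rewrite big_ord_recl point_mulE; apply: eq_tlift => a b.
rewrite -(IHn (fun i => gam i.+1)) (lin_sweedler _ (@linear_mull K A _)).
by apply: eq_sweedler => s; rewrite (prod_fins gam ord0).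
Qed.

Lemma prod_telescope n gam : (\prod_(i < n) (gam i / gam i.+1) = gam 0 / gam n)%g.
Proof.
elim: n => [|n IHn]; first by rewrite big_ord0 mulgV.
by rewrite big_ord_recr /= IHn mul_divg.
Qed.

Definition cycidx q k := if k is k'.+1 then k' else q.

(** In positive degree n, the iterated coproduct of S(f^1) meets the product of all quotients, which
    telescopes to gam_0 / gam_n. The antipode inverts it to gam_n / gam_0, one of the quotients of
    the rotated family, and the coaction factor turns the action of gam_n into that of gam_{n-1}. *)
Lemma homog_cyc q (t : C q) gam : homog (cyc t) gam = homog t (fun k => gam (cycidx q k)).
Proof.
case: q t => [|q] t.
  rewrite -[cyc t]/t; move: t; apply: mtens_ext => [||v f]; try exact: homog_linear.
  by rewrite !homog_pure !big_ord0.
move: t; apply: mtens_ext => [||v f].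
- exact: linear_comp (homog_linear gam) (@cyc_is_linear _ _ H V _).
- exact: homog_linear.
rewrite /cyc mlift_pure; last exact: cyc_multilin.
rewrite /cyc_fun (lin_tlift (homog_linear gam)) homog_pure big_ord_recl.
transitivity (pt_act (gam q.+1) (pt_act (gam q / gam q.+1)%g
    (tpure v ((gam q.+1 / gam 0)%g (f ord0)
              * \prod_(i < q) (gam i / gam i.+1)%g (f (lift ord0 i)))))); last first.
  by rewrite -pt_actM mulgVK.
rewrite [in RHS]pt_act_pure (lin_tlift (pt_act_linear _)); apply: eq_tlift => c w.
rewrite (lin_sweedler _ (homog_linear gam)).
set r := \prod_(i < q) _.
pose d i := (gam i / gam i.+1)%g.
have lin1 : linear (fun x => pt_act (gam q.+1) (tpure w (x * (d q c * r)))).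
  apply: linear_comp (pt_act_linear _) _; apply: linear_comp (@tpure_linearr V A w) _.
  exact: linear_mulr.
transitivity (sweedler H (fun s => pt_act (gam q.+1)
    (tpure w ((\prod_(i < q.+1) d i (s i)) * (d q c * r)))) (antip H (f ord0))).
  apply: eq_sweedler => s; rewrite homog_pure; congr (pt_act _ (tpure _ _)).
  transitivity (\prod_(i < q.+1) (d i (s i) * d i (fins ord_max c (fdel ord0 f) i))).
    by apply: eq_bigr => i _; rewrite ffunE pointM.
  rewrite big_split /= (prod_fins d); congr (_ * (_ * _)).
  by apply: eq_bigr => i _; rewrite bump_small // ffunE.
rewrite -(lin_sweedler _ lin1) sweedler_prod prod_telescope -point_invE.
by rewrite invgM invgK mulrCA.
Qed.

End Evaluation.

(** * Universal points *)

Section TensorPower.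
Variables (K : fieldType) (F : comAlgType K) (H : hopf F) (n : nat).

(** Taking [mtens] with scalar coefficients treats the zeroth power, which is the ground field, on
    the same footing as the others. *)
Definition tpower : Type := mtens (K^o : lmodType K) F n.
HB.instance Definition _ := GRing.Lmodule.on tpower.
Local Notation Ko := (K^o : lmodType K).
Local Notation fam := {ffun 'I_n -> F}.

Definition fmul (f g : fam) : fam := [ffun i => f i * g i].

Definition tpow_mul_fun (s : tpower) (a : Ko) (f : fam) : tpower :=
  mlift (fun (b : Ko) g => mpure (a * b : Ko) (fmul f g)) s.

Lemma fmul_updl i x (f g : fam) : fmul (fupd i x f) g = fupd i (x * g i) (fmul f g).
Proof. by apply/ffunP=> k; rewrite !ffunE; case: eqP => // ->. Qed.

Lemma fmulC (f g : fam) : fmul f g = fmul g f.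
Proof. by apply/ffunP=> k; rewrite !ffunE mulrC. Qed.

Lemma fmulA (f g h : fam) : fmul f (fmul g h) = fmul (fmul f g) h.
Proof. by apply/ffunP=> k; rewrite !ffunE mulrA. Qed.

Lemma tpow_mul_multilinl (b : Ko) (g : fam) :
  multilin (fun (a : Ko) f => mpure (a * b : Ko) (fmul f g) : tpower).
Proof.
have [m1 m2] := mpure_multilin Ko F n; split=> [f|a i f].
  by apply: linear_comp (m1 _) _ => c x y; rewrite mulrDl -scalerAl.
by move=> c x y; rewrite !fmul_updl mulrDl -scalerAl m2.
Qed.

Lemma tpow_mul_multilinr (a : Ko) (f : fam) :
  multilin (fun (b : Ko) g => mpure (a * b : Ko) (fmul f g) : tpower).
Proof.
have [m1 m2] := tpow_mul_multilinl a f; split=> [g|b i g] c x y.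
  by have := m1 g c x y; rewrite !(mulrC a) fmulC.
by have := m2 b i g c x y; rewrite !(mulrC a) !(fmulC f).
Qed.

Lemma tpow_mul_fun_multilin s : multilin (tpow_mul_fun s).
Proof.
split=> [f|a i f] c x y; rewrite /tpow_mul_fun -mlift_phi_linear; apply: eq_mlift => b g.
  exact: (tpow_mul_multilinl b g).1.
exact: (tpow_mul_multilinl b g).2.
Qed.

Definition tpow_mul (t s : tpower) : tpower := mlift (tpow_mul_fun s) t.

Lemma tpow_mul_pure (a b : Ko) f g :
  tpow_mul (mpure a f) (mpure b g) = mpure (a * b : Ko) (fmul f g).
Proof.
rewrite /tpow_mul mlift_pure; last exact: tpow_mul_fun_multilin.
by rewrite /tpow_mul_fun mlift_pure //; exact: tpow_mul_multilinr.
Qed.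

Lemma tpow_mul_linearl s : linear (tpow_mul^~ s).
Proof. exact: mlift_linear (tpow_mul_fun_multilin s). Qed.

Lemma tpow_mul_linearr t : linear (tpow_mul t).
Proof.
move=> c x y; apply: etrans (mlift_phi_linear c _ _ t); apply: eq_mlift => a f.
exact: (mlift_linear (tpow_mul_multilinr a f)).
Qed.

Definition tpow_one : tpower := mpure (1 : Ko) [ffun=> 1].

Lemma tpow_mulC : commutative tpow_mul.
Proof.
move=> t s; move: t; apply: mtens_ext => [||a f].
- exact: tpow_mul_linearl.
- exact: tpow_mul_linearr.
move: s; apply: mtens_ext => [||b g].
- exact: tpow_mul_linearr.
- exact: tpow_mul_linearl.
apply: etrans (tpow_mul_pure a b f g) (etrans _ (esym (tpow_mul_pure b a g f))).
by rewrite (mulrC a b) (fmulC f).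
Qed.

Lemma tpow_mulA : associative tpow_mul.
Proof.
move=> t s u; move: t; apply: mtens_ext => [||a f].
- exact: tpow_mul_linearl.
- exact: linear_comp (tpow_mul_linearl u) (tpow_mul_linearl s).
move: s; apply: mtens_ext => [||b g].
- exact: linear_comp (tpow_mul_linearr _) (tpow_mul_linearl u).
- exact: linear_comp (tpow_mul_linearl u) (tpow_mul_linearr _).
move: u; apply: mtens_ext => [||c h].
- exact: linear_comp (tpow_mul_linearr _) (tpow_mul_linearr _).
- exact: tpow_mul_linearr.
apply: etrans (congr1 (tpow_mul _) (tpow_mul_pure b c g h)) _.
apply: etrans (tpow_mul_pure a _ f _) _.
apply: etrans _ (esym (congr1 (tpow_mul^~ _) (tpow_mul_pure a b f g))).
apply: etrans _ (esym (tpow_mul_pure _ c _ h)).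
by rewrite (mulrA a b c) (fmulA f).
Qed.

Lemma tpow_mul1 : left_id tpow_one tpow_mul.
Proof.
apply: mtens_ext => [||a f] //; first exact: tpow_mul_linearr.
rewrite tpow_mul_pure mul1r; congr mpure; apply/ffunP => i.
by rewrite !ffunE mul1r.
Qed.

Lemma tpow_mulDl : left_distributive tpow_mul +%R.
Proof. by move=> x y z; rewrite (linear_funD (tpow_mul_linearl z)). Qed.

(** The product of the counits is a linear form taking the value 1 on the unit. *)
Lemma tpow_one_neq0 : tpow_one != 0.
Proof.
pose phi (a : Ko) (f : fam) : Ko := a * \prod_(i < n) counit H (f i).
have phiP : multilin phi.
  split=> [f|a i f] c x y; first by rewrite /phi mulrDl -scalerAl.
  have E z : phi a (fupd i z f)
      = counit H z * (a * \prod_(j < n | j != i) counit H (f j)).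
    by rewrite /phi (prod_fupd (fun=> counit H)) mulrCA.
  rewrite !E (linearP (counit H)) mulrDl; congr (_ + _); exact: esym (mulrA _ _ _).
apply/eqP => /(congr1 (mlift phi)); rewrite (linear_fun0 (mlift_linear phiP)).
rewrite mlift_pure // /phi mul1r big1 => [|i _]; last by rewrite ffunE counit1.
by apply/eqP; exact: oner_neq0.
Qed.

HB.instance Definition _ := GRing.Zmodule_isComNzRing.Build tpower
  tpow_mulA tpow_mulC tpow_mul1 tpow_mulDl tpow_one_neq0.

Lemma tpow_scaleAl (a : K) (x y : tpower) : a *: (x * y) = a *: x * y.
Proof. by rewrite -(linear_funZ (tpow_mul_linearl y)). Qed.

HB.instance Definition _ := GRing.Lmodule_isLalgebra.Build K tpower tpow_scaleAl.
HB.instance Definition _ := GRing.Lalgebra_isComAlgebra.Build K tpower.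

Lemma tpow_mulE (a b : Ko) f g :
  (mpure a f : tpower) * mpure b g = mpure (a * b : Ko) (fmul f g).
Proof. exact: tpow_mul_pure. Qed.

Definition univ_fun (i : 'I_n) (x : F) : tpower := mpure (1 : Ko) (fupd i x [ffun=> 1]).

Lemma univ_linear i : linear (univ_fun i).
Proof. exact: (mpure_multilin Ko F n).2. Qed.

Lemma univ1 i : univ_fun i 1 = 1.
Proof.
by congr mpure; apply/ffunP => j; rewrite !ffunE; case: eqP.
Qed.

Lemma univM i x y : univ_fun i (x * y) = univ_fun i x * univ_fun i y.
Proof.
rewrite tpow_mulE mulr1; congr mpure; apply/ffunP => j; rewrite !ffunE.
by case: eqP => _; rewrite ?mulr1.
Qed.

Definition univ_ord i : point H tpower := Point H (univ_linear i) (univ1 i) (univM i).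

(** Indices from [n] on receive the unit of the group as default value. *)
Definition univ (k : nat) : point H tpower := oapp univ_ord 1%g (insub k).

Lemma prod_univ (f : fam) : \prod_(i < n) univ i (f i) = mpure (1 : Ko) f.
Proof.
have -> : \prod_(i < n) univ i (f i)
    = \prod_(i < n) (mpure (1 : Ko) (fupd i (f i) [ffun=> 1]) : tpower).
  by apply: eq_bigr => i _; rewrite /univ valK.
have mM : {morph (fun f : fam => mpure (1 : Ko) f : tpower) : x y / fmul x y >-> x * y}.
  by move=> x y /=; rewrite tpow_mulE mulr1.
rewrite -(big_morph _ mM (erefl : mpure 1 [ffun=> 1] = 1 :> tpower)).
congr mpure; apply/ffunP => j.
rewrite (big_morph (fun f : fam => f j) (id1 := 1) (op1 := *%R)); last first.
- by rewrite ffunE.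
- by move=> x y; rewrite ffunE.
rewrite (prodD1 j) fupd_same big1 ?mulr1 // => i ij.
by rewrite fupd_other 1?eq_sym // ffunE.
Qed.

End TensorPower.

Section HomogeneousCochains.
Variables (K : fieldType) (F : comAlgType K) (H : hopf F) (V : comodule H).
Local Notation C q := (mtens V F q).

Lemma eq_ev (A : comAlgType K) q (g h : nat -> point H A) (t : C q) :
  (forall i, (i < q)%N -> g i = h i) -> ev g t = ev h t.
Proof.
move=> gh; move: t; apply: mtens_ext => [||v f]; try exact: ev_linear.
rewrite !ev_pure; congr tpure; apply: eq_bigr => i _.
by rewrite gh.
Qed.

Definition univ_retract_fun q (v : V) (a : tpower F q) : C q :=
  mlift (fun (k : (K^o : lmodType K)) (f : {ffun 'I_q -> F}) => (k : K) *: mpure v f) a.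

Lemma univ_retract_multilin q (v : V) :
  multilin (fun (k : (K^o : lmodType K)) (f : {ffun 'I_q -> F}) => (k : K) *: mpure v f).
Proof.
split=> [f|k i f] c x y; first by rewrite scalerDl scalerA.
by rewrite (mpure_multilin V F q).2 scalerDr !scalerA mulrC.
Qed.

Lemma univ_retract_bilin q : bilin (@univ_retract_fun q).
Proof.
split=> [a|v]; last exact: mlift_linear (univ_retract_multilin q v).
move=> c v v'; apply: etrans (mlift_phi_linear c _ _ a); apply: eq_mlift => k f.
by rewrite (mpure_multilin V F q).1 scalerDr !scalerA mulrC.
Qed.

(** A left inverse of evaluation at the universal points, so that these points separate cochains. *)
Definition univ_retract q : tens V (tpower F q) -> C q := tlift (@univ_retract_fun q).

Lemma univ_retractK q (t : C q) : univ_retract (ev (univ H q) t) = t.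
Proof.
move: t; apply: mtens_ext => [||v f] //.
  exact: linear_comp (tlift_linear (@univ_retract_bilin q)) (ev_linear _).
rewrite ev_pure prod_univ /univ_retract (tlift_pure (@univ_retract_bilin q)).
by rewrite /univ_retract_fun (mlift_pure (univ_retract_multilin q v)) scale1r.
Qed.

Lemma homog_ext q (t t' : C q) :
  (forall (A : comAlgType K) (gam : nat -> point H A), homog t gam = homog t' gam) -> t = t'.
Proof.
(* With these partial products gam_i / gam_{i+1} is the i-th universal point and gam_q is the unit,
   so homogeneous evaluation becomes evaluation at the universal points. *)
move=> e; pose gam k := (\prod_(k <= i < q) univ H q i)%g.
have homE (x : C q) : homog x gam = ev (univ H q) x.
  rewrite /homog /gam big_geq // pt_act1; apply: eq_ev => i iq.
  by rewrite (big_ltn iq) mulgK.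
have E := etrans (esym (homE t)) (etrans (e _ gam) (homE t')).
exact: etrans (esym (univ_retractK t)) (etrans (congr1 _ E) (univ_retractK t')).
Qed.

End HomogeneousCochains.

(** * Cocyclic modules *)

(** The terms cancel in pairs (j+1, i) and (i, j) with i <= j; the induction strips the last row and
    the last column. *)
Lemma alternating_double_sum (M : zmodType) (a : nat -> nat -> M) n :
  (forall i j, (i <= j)%N -> (j < n)%N -> a j.+1 i = - a i j) ->
  \sum_(0 <= j < n.+1) \sum_(0 <= i < n) a j i = 0.
Proof.
elim: n => [|n IHn] aS; first by rewrite big_nat1 big_nil.
rewrite (eq_bigr (fun j => \sum_(0 <= i < n) a j i + a j n)); last first.
  by move=> j _; rewrite big_nat_recr.
rewrite big_split /= big_nat_recr //= IHn => [|i j ij jn]; last first.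
  by rewrite aS // leqW.
rewrite add0r !big_nat_recr //= (aS n n) // addrK -big_split /=.
rewrite big_nat big1 // => i /andP[_ ni].
by rewrite aS // ?addNr // ltnW.
Qed.

Lemma sum_two (M : zmodType) (f : nat -> M) n j : (j.+1 < n)%N ->
    (forall m, (m < n)%N -> m != j -> m != j.+1 -> f m = 0) ->
  \sum_(0 <= m < n) f m = f j + f j.+1.
Proof.
move=> jn f0; have jn' := ltnW jn.
rewrite (big_cat_nat (n := j)) //= ?(ltnW jn') // (big_cat_nat (m := j) (n := j.+2)) ?leqW //=.
rewrite big_nat big1 => [|m /andP[_ mj]]; last first.
  by rewrite f0 ?(ltn_trans mj) // neq_ltn ?mj // ltnW.
rewrite add0r big_nat_recr //= big_nat1 big_nat big1 ?addr0 // => m /andP[jm mn].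
by rewrite f0 // gtn_eqF // ltnW.
Qed.

Section CocyclicModule.
Variables (K : fieldType) (C : nat -> lmodType K).
Variables (d : forall {q}, nat -> C q -> C q.+1) (s : forall {q}, nat -> C q.+1 -> C q).
Variable t : forall {q}, C q -> C q.

Hypothesis d_linear : forall q i, linear (@d q i).
Hypothesis s_linear : forall q i, linear (@s q i).
Hypothesis t_linear : forall q, linear (@t q).
Hypothesis dd : forall q i j (x : C q), (i <= j)%N -> (j <= q.+1)%N ->
  d j.+1 (d i x) = d i (d j x).
Hypothesis sd_lt : forall q i j (x : C q.+1), (i <= j)%N -> (j <= q)%N ->
  s j.+1 (d i x) = d i (s j x).
Hypothesis sd_eq : forall q j (x : C q), (j <= q)%N -> s j (d j x) = x.
Hypothesis sd_eqS : forall q j (x : C q), (j <= q)%N -> s j (d j.+1 x) = x.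
Hypothesis sd_gt : forall q i j (x : C q.+1), (j < i)%N -> (i <= q.+1)%N ->
  s j (d i.+1 x) = d i (s j x).
Hypothesis ss : forall q i j (x : C q.+2), (i <= j)%N -> (j <= q)%N ->
  s j (s i x) = s i (s j.+1 x).
Hypothesis td : forall q i (x : C q), (i <= q)%N -> t (d i.+1 x) = d i (t x).
Hypothesis td0 : forall q (x : C q), t (d 0 x) = d q.+1 x.
Hypothesis st : forall q j (x : C q.+1), (j < q)%N -> s j (t x) = t (s j.+1 x).
Hypothesis stt : forall q (x : C q.+1), s q (t (t x)) = t (s 0 x).
Hypothesis t_order : forall q (x : C q), iter q.+1 t x = x.

Definition cob q (x : C q) : C q.+1 := \sum_(0 <= i < q.+2) (-1) ^+ i *: d i x.

Lemma cob_linear q : linear (@cob q).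
Proof.
move=> a x y; rewrite /cob scaler_sumr -big_split; apply: eq_bigr => i _ /=.
by rewrite d_linear scalerDr !scalerA mulrC.
Qed.

Lemma cob_cob q (x : C q) : cob (cob x) = 0.
Proof.
pose a j i := (-1) ^+ (i + j) *: d j (d i x).
have <- : \sum_(0 <= j < q.+3) \sum_(0 <= i < q.+2) a j i = cob (cob x).
  apply: eq_bigr => j _; rewrite /cob (linear_fun_sum (@d_linear _ j)) scaler_sumr.
  by apply: eq_bigr => i _; rewrite (linear_funZ (@d_linear _ j)) scalerA -exprD addnC.
apply: alternating_double_sum => i j ij jq.
by rewrite /a dd // addnS exprS mulN1r scaleNr addnC.
Qed.

(** * Normalized cochains of a cocyclic module *)

Definition vanish k q : C q -> Prop :=
  match q with
  | 0 => fun=> True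
  | q'.+1 => fun x => forall i, (i < k)%N -> (i <= q')%N -> s i x = 0
  end.

Lemma vanish_sd_lt k q (x : C q) j m : vanish k x ->
  (m < j)%N -> (j <= k)%N -> (j <= q)%N -> s j (d m x) = 0.
Proof.
case: q x => [|q] x vx; case: j => // j mj jk jq.
by rewrite sd_lt // vx // (linear_fun0 (@d_linear _ m)).
Qed.

Lemma vanish_sd_gt k q (x : C q) j m : vanish k x ->
  (j < k)%N -> (j.+1 < m)%N -> (m <= q.+1)%N -> s j (d m x) = 0.
Proof.
case: q x => [|q] x vx; case: m => // m jk jm mq.
  by case: m jm mq.
by rewrite sd_gt // vx // ?(linear_fun0 (@d_linear _ m)) //; exact: leq_trans jm mq.
Qed.

(** Only the faces j and j+1 survive under s_j, and they contribute x with opposite signs. *)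
Lemma s_cob k q (x : C q) j : vanish k x -> (j < k)%N -> (j <= q)%N -> s j (cob x) = 0.
Proof.
move=> vx jk jq; rewrite /cob (linear_fun_sum (@s_linear _ j)) (@sum_two _ _ _ j) //.
  rewrite !(linear_funZ (@s_linear _ j)) sd_eq // sd_eqS //.
  by rewrite exprS mulN1r scaleNr subrr.
move=> m mq mj mj1; rewrite (linear_funZ (@s_linear _ j)).
case: (ltngtP m j) mj => // mj _; first by rewrite (vanish_sd_lt vx) ?scaler0 // ltnW.
by rewrite (vanish_sd_gt vx) ?scaler0 // ltn_neqAle eq_sym mj1.
Qed.

Definition nondeg q (x : C q) : Prop := vanish q x.

Lemma nondegS q (x : C q.+1) : nondeg x <-> forall j, (j <= q)%N -> s j x = 0.
Proof. by split=> [nx j jq|nx j _ jq]; apply: nx. Qed.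

Lemma nondeg_cob q (x : C q) : nondeg x -> nondeg (cob x).
Proof.
move=> nx; apply/nondegS => j jq; apply: (s_cob (k := q.+1)) => //.
by case: q x nx jq => // q x nx jq i _ iq; apply: nx.
Qed.

(** The sign is dictated by s_k (cob u) = (-1)^k u for u = s_k x. The codegeneracies below k kill
    both x and cob u, so the vanishing already achieved is kept. *)
Lemma vanish_step q k (x : C q.+1) : (k <= q)%N -> nondeg (cob x) -> vanish k x ->
  vanish k.+1 (x - (-1) ^+ k *: cob (s k x)).
Proof.
move=> kq /nondegS nx vx; set u := s k x.
have vu : vanish k u.
  case: q x kq vx @u {nx} => // q x; case: k => // k kq vx u i ik iq.
  by rewrite /u -ss // vx ?(linear_fun0 (@s_linear _ _)) // leqW.
(* Applying s_k to cob x isolates the faces of u beyond the k-th one. *)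
have d0 : \sum_(k.+1 <= m < q.+2) (-1) ^+ m *: d m u = 0.
  have kq2 : (k < q.+2)%N by rewrite ltnS leqW.
  have := nx k (leqW kq); rewrite /cob (linear_fun_sum (@s_linear _ k)).
  rewrite (big_cat_nat (leq0n k) (leqW (ltnW kq2))) /= big_nat big1 => [|m /andP[_ mk]].
    rewrite add0r (big_ltn (leqW kq2)) (big_ltn (kq2 : (k.+1 < q.+3)%N)).
    rewrite !(linear_funZ (@s_linear _ k)) sd_eq ?sd_eqS ?leqW // addrA.
    rewrite exprS mulN1r scaleNr subrr add0r big_add1 /= => e.
    apply/eqP; rewrite -oppr_eq0 -sumrN -[X in _ == X]e; apply/eqP.
    apply: eq_big_nat => m /andP[km mq].
    by rewrite (linear_funZ (@s_linear _ k)) sd_gt // exprS mulN1r scaleNr.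
  by rewrite (linear_funZ (@s_linear _ k)) (vanish_sd_lt vx) ?scaler0 // leqW.
have cobu : cob u = \sum_(0 <= m < k.+1) (-1) ^+ m *: d m u.
  by rewrite /cob (big_cat_nat (n := k.+1)) //= ?d0 ?addr0 // ltnS leqW.
move=> i ik iq; rewrite (linear_funB (@s_linear _ i)) (linear_funZ (@s_linear _ i)).
have [->|i_neq_k] := eqVneq i k; last first.
  have {ik}ik : (i < k)%N by rewrite ltn_neqAle i_neq_k.
  by rewrite vx // (s_cob vu) // scaler0 subr0.
rewrite cobu (linear_fun_sum (@s_linear _ k)) big_nat_recr //= big_nat big1.
  rewrite add0r (linear_funZ (@s_linear _ k)) sd_eq // scalerA -exprD.
  by rewrite addnn -signr_odd odd_double scale1r subrr.
move=> m /andP[_ mk]; rewrite (linear_funZ (@s_linear _ k)).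
by rewrite (vanish_sd_lt vu) ?scaler0.
Qed.

(** The correcting coboundary is built one codegeneracy at a time. Asking only that cob x be
    nondegenerate lets the statement apply to cocycles and to primitives of nondegenerate
    coboundaries alike. *)
Lemma normalization q (x : C q.+1) : nondeg (cob x) ->
  exists z : C q, nondeg (x - cob z).
Proof.
move=> nx; suff: forall k, (k <= q.+1)%N -> exists z : C q, vanish k (x - cob z).
  by apply.
elim=> [|k IHk] kq; first by exists 0.
have [z vz] := IHk (ltnW kq); pose y := x - cob z.
have ny : nondeg (cob y).
  by rewrite /y (linear_funB (@cob_linear _)) cob_cob subr0.
exists (z + (-1) ^+ k *: s k y).
rewrite (linear_funD (@cob_linear _)) (linear_funZ (@cob_linear _)) opprD addrA.
exact: vanish_step.
Qed.

(** * Cyclic operators and the relations of the mixed complex *)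

Definition lam q (x : C q) : C q := (-1) ^+ q *: t x.
Definition cycnorm q (x : C q) : C q := \sum_(0 <= i < q.+1) iter i (@lam q) x.
(** The extra codegeneracy of cyclic theory; [cob'] is the differential b', the coboundary without
    its last face. *)
Definition xdeg q (x : C q.+1) : C q := s q (t x).
Definition cob' q (x : C q) : C q.+1 := \sum_(0 <= i < q.+1) (-1) ^+ i *: d i x.

Lemma lam_linear q : linear (@lam q).
Proof. by move=> a x y; rewrite /lam t_linear scalerDr !scalerA mulrC. Qed.

Lemma iter_linear (M : lmodType K) (f : M -> M) n : linear f -> linear (iter n f).
Proof. by move=> lf a x y; elim: n => //= n ->; rewrite lf. Qed.

Lemma cycnorm_linear q : linear (@cycnorm q).
Proof.
move=> a x y; rewrite /cycnorm scaler_sumr -big_split; apply: eq_bigr => i _ /=.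
exact: (iter_linear i (@lam_linear q)).
Qed.

Lemma xdeg_linear q : linear (@xdeg q).
Proof. by move=> a x y; rewrite /xdeg t_linear s_linear. Qed.

Lemma iter_lam q n (x : C q) : iter n (@lam q) x = (-1) ^+ (q * n) *: iter n t x.
Proof.
elim: n => [|n IHn] /=; first by rewrite muln0 scale1r.
by rewrite IHn /lam (linear_funZ (@t_linear q)) scalerA -exprD mulnS.
Qed.

Lemma lam_order q (x : C q) : iter q.+1 (@lam q) x = x.
Proof. by rewrite iter_lam t_order -signr_odd oddM /= andbN scale1r. Qed.

Lemma cycnorm_lam q (x : C q) : cycnorm (lam x) = cycnorm x.
Proof.
rewrite /cycnorm big_nat_recr //= [RHS]big_nat_recl //= addrC -iterSr lam_order.
by congr (_ + _); apply: eq_bigr => i _; rewrite -iterSr.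
Qed.

Lemma lam_cycnorm q (x : C q) : lam (cycnorm x) = cycnorm x.
Proof.
rewrite -[RHS]cycnorm_lam /cycnorm (linear_fun_sum (@lam_linear q)).
by apply: eq_bigr => i _; rewrite -iterSr.
Qed.

Lemma iter_lam_cycnorm q n (x : C q) : iter n (@lam q) (cycnorm x) = cycnorm x.
Proof. by elim: n => //= n ->; rewrite lam_cycnorm. Qed.

Lemma cycnorm_iter_lam q n (x : C q) : cycnorm (iter n (@lam q) x) = cycnorm x.
Proof. by elim: n => //= n <-; rewrite cycnorm_lam. Qed.

Lemma iter_td q i (x : C q) : (i <= q.+1)%N -> iter i t (d i x) = d 0 (iter i t x).
Proof.
elim: i x => // i IHi x iq; rewrite iterSr td // IHi ?iterSr //; exact: ltnW.
Qed.

(* All cofaces are rotations of the first one; this turns the identities between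
   the two differentials and the norm into telescoping sums. *)
Definition rotated_coface q i (x : C q) : C q.+1 :=
  iter (q.+2 - i) (@lam q.+1) (d 0 (iter i (@lam q) x)).

(** From t^i d_i = d_0 t^i and the order q+2 of t on the target, d_i is d_0 between two rotations.
    The signs of [lam] combine to (-1)^i because (q+1)(q+2-i) + qi has the parity of i. *)
Lemma rotated_cofaceE q i (x : C q) : (i <= q.+1)%N ->
  rotated_coface i x = (-1) ^+ i *: d i x.
Proof.
move=> iq; rewrite /rotated_coface !iter_lam (linear_funZ (@d_linear _ _)).
rewrite (linear_funZ (iter_linear _ (@t_linear _))) -iter_td //.
rewrite -iterD subnK 1?leqW // t_order scalerA -exprD.
congr (_ *: _); rewrite -signr_odd -[RHS]signr_odd; congr (_ ^+ _).
rewrite oddD !oddM oddB 1?leqW //= negbK.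
by case: (odd q) (odd i) => [] [].
Qed.

Lemma cob_rotated q (x : C q) : cob x = \sum_(0 <= i < q.+2) rotated_coface i x.
Proof. by apply: eq_big_nat => i /andP[_ iq]; rewrite rotated_cofaceE. Qed.

Lemma cob'_rotated q (x : C q) : cob' x = \sum_(0 <= i < q.+1) rotated_coface i x.
Proof. by apply: eq_big_nat => i /andP[_ iq]; rewrite rotated_cofaceE 1?ltnW. Qed.

Lemma cob'_linear q : linear (@cob' q).
Proof.
move=> a x y; rewrite /cob' scaler_sumr -big_split; apply: eq_bigr => i _ /=.
by rewrite d_linear scalerDr !scalerA mulrC.
Qed.

Lemma rotated_coface_lam q i (x : C q) : (i <= q.+1)%N ->
  rotated_coface i (lam x) = lam (rotated_coface i.+1 x).
Proof. by move=> iq; rewrite /rotated_coface -iterSr -iterS subSS subSn. Qed.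

(** Moving [lam] across a rotated coface shifts its index by one. The sums then differ only at their
    ends, where the rotated coface q+1 is [lam] of the rotated coface 0. *)
Lemma cob_sublam q (x : C q) : cob' (x - lam x) = cob x - lam (cob x).
Proof.
rewrite (linear_funB (@cob'_linear q)) !cob'_rotated !cob_rotated.
rewrite (eq_big_nat _ _ (F1 := fun i => rotated_coface i (lam x))
  (F2 := fun i => lam (rotated_coface i.+1 x))); last first.
  by move=> i /andP[_ iq]; rewrite rotated_coface_lam // ltnW.
rewrite -(linear_fun_sum (@lam_linear _)) [X in _ = X - _]big_nat_recr //=.
rewrite [X in _ = _ - lam X]big_nat_recl //= (linear_funD (@lam_linear _)).
have -> : rotated_coface q.+1 x = lam (rotated_coface 0 x).
  by rewrite /rotated_coface subSnn subn0 lam_order lam_order.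
by rewrite opprD addrA addrK.
Qed.

(** The norm absorbs the outer rotations on the left side and the inner ones on the right side; both
    sides become the norm of d_0 applied to the norm of x. *)
Lemma cycnorm_cob' q (x : C q) : cycnorm (cob' x) = cob (cycnorm x).
Proof.
rewrite cob'_rotated cob_rotated (linear_fun_sum (@cycnorm_linear _)).
rewrite (eq_bigr (fun i => cycnorm (d 0 (iter i (@lam q) x)))); last first.
  by move=> i _; rewrite /rotated_coface cycnorm_iter_lam.
rewrite -(linear_fun_sum (@cycnorm_linear _)) -(linear_fun_sum (@d_linear _ 0)).
rewrite -/(cycnorm x); set y := d 0 _.
rewrite (eq_bigr (fun i => iter (q.+2 - i) (@lam q.+1) y)); last first.
  by move=> i _; rewrite /rotated_coface iter_lam_cycnorm.
rewrite big_nat_rev /= add0n -cycnorm_lam; apply: eq_big_nat => i /andP[_ iq].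
by rewrite -iterSr subKn.
Qed.

Lemma xdeg_d0 q (x : C q) : xdeg (d 0 x) = x.
Proof. by rewrite /xdeg td0 sd_eqS. Qed.

(** The extra codegeneracy is a contracting homotopy for b': it splits d_0 and commutes with the
    other faces up to a shift of index. *)
Lemma xdeg_cob' q (x : C q.+1) : xdeg (cob' x) = x - cob' (xdeg x).
Proof.
rewrite /cob' (linear_fun_sum (@xdeg_linear _)) big_nat_recl //= scale1r xdeg_d0.
congr (_ + _); rewrite -sumrN; apply: eq_big_nat => i /andP[_ iq].
rewrite (linear_funZ (@xdeg_linear _)) exprS mulN1r scaleNr.
by rewrite /xdeg td 1?ltnW // sd_lt.
Qed.

Lemma xdeg_t q (x : C q.+1) : nondeg x -> xdeg (t x) = 0.
Proof.
by move/nondegS=> nx; rewrite /xdeg stt nx ?(linear_fun0 (@t_linear _)).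
Qed.

Definition boundary q (x : C q.+1) : C q := cycnorm (xdeg x).

(** A codegeneracy is pushed through the rotations until it reaches x. Wrapping around by s_q t t =
    t s_0 consumes two rotations at once, hence the strong induction. *)
Lemma xdeg_iter_nondeg q (x : C q.+2) i j : nondeg x -> (j <= q)%N ->
  s j (iter i t (xdeg x)) = 0.
Proof.
move=> nx; have nx' := (nondegS x).1 nx; elim/ltn_ind: i j => -[_|i IHi] j jq.
  by rewrite /= /xdeg -ss // st // nx' // (linear_fun0 (@t_linear _)) (linear_fun0 (@s_linear _ _)).
have [jltq|] := ltnP j q; first by rewrite /= st // IHi // (linear_fun0 (@t_linear _)).
rewrite leq_eqVlt ltnNge jq orbF => /eqP <-.
case: i IHi => [|i] IHi; last by rewrite /= stt IHi // (linear_fun0 (@t_linear _)).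
by rewrite /= /xdeg -st // ss // stt nx' // (linear_fun0 (@t_linear _)) (linear_fun0 (@s_linear _ _)).
Qed.

Lemma boundary_nondeg q (x : C q.+1) : nondeg x -> nondeg (boundary x).
Proof.
case: q x => // q x nx; apply/nondegS => j jq.
rewrite /boundary /cycnorm (linear_fun_sum (@s_linear _ j)) big1 // => i _.
by rewrite iter_lam (linear_funZ (@s_linear _ j)) xdeg_iter_nondeg // scaler0.
Qed.

Lemma boundary_boundary q (x : C q.+2) : nondeg x -> boundary (boundary x) = 0.
Proof.
move=> nx; rewrite {1}/boundary.
have -> : xdeg (boundary x) = 0; last exact: linear_fun0 (@cycnorm_linear _).
rewrite /boundary /cycnorm (linear_fun_sum (@xdeg_linear _)) big1 // => i _.
rewrite iter_lam (linear_funZ (@xdeg_linear _)) /xdeg -iterS.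
by rewrite xdeg_iter_nondeg // scaler0.
Qed.

(** Write N for the norm and s for the extra codegeneracy. Then N s b x = N s (1 - lam) b x = N s b'
    y with y = (1 - lam) x. The homotopy gives N y - N b' s y, where N y = 0 and N b' = b N, and s y
    = s x. *)
Lemma boundary_cob q (x : C q.+1) : nondeg x -> boundary (cob x) = - cob (boundary x).
Proof.
move=> nx; pose y := x - lam x.
have xdeg_lam r (z : C r.+1) : nondeg z -> xdeg (lam z) = 0.
  by move=> nz; rewrite /lam (linear_funZ (@xdeg_linear _)) xdeg_t ?scaler0.
rewrite /boundary -[xdeg (cob x)]subr0 -(xdeg_lam _ _ (nondeg_cob nx)).
rewrite -(linear_funB (@xdeg_linear _)) -cob_sublam -/y xdeg_cob'.
rewrite (linear_funB (@cycnorm_linear _)) cycnorm_cob' /y.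
rewrite (linear_funB (@cycnorm_linear _)) cycnorm_lam subrr sub0r.
by rewrite (linear_funB (@xdeg_linear _)) xdeg_lam // subr0.
Qed.

(** The rotation of degree 0 is the identity, so the extra codegeneracy sends both faces of x to
    x. *)
Lemma boundary_cob0 (x : C 0) : boundary (cob x) = 0.
Proof.
rewrite /boundary /cob big_nat_recl // big_nat1 scale1r (linear_funD (@xdeg_linear _)).
rewrite (linear_funZ (@xdeg_linear _)) xdeg_d0 /xdeg td // sd_eq // (t_order x : t x = x).
by rewrite scaleN1r subrr (linear_fun0 (@cycnorm_linear _)).
Qed.

End CocyclicModule.

(** * The cocyclic identities of Hopf-cyclic cochains *)

Section HopfCocyclic.
Variables (K : fieldType) (F : comAlgType K) (H : hopf F) (V : comodule H).
Local Notation C q := (mtens V F q).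

Definition cof q i (x : C q) : C q.+1 := coface (inord i) x.
Definition cod q j (x : C q.+1) : C q := codegen (inord j) x.

Lemma cof_linear q i : linear (@cof q i).
Proof. exact: coface_is_linear. Qed.

Lemma cod_linear q j : linear (@cod q j).
Proof. exact: codegen_is_linear. Qed.

Definition reindexes q r (f : C q -> C r) (e : nat -> nat) : Prop :=
  forall (A : comAlgType K) (gam : nat -> point H A) x,
    homog (f x) gam = homog x (fun k => gam (e k)).

Lemma eq_homog (A : comAlgType K) q (x : C q) (gam gam' : nat -> point H A) :
  (forall k, (k <= q)%N -> gam k = gam' k) -> homog x gam = homog x gam'.
Proof.
move=> e; rewrite /homog (e q (leqnn q)); apply: (congr1 (pt_act _)).
by apply: eq_ev => i iq; rewrite (e i (ltnW iq)) (e i.+1 iq).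
Qed.

(** Since homogeneous coordinates determine a cochain, every cocyclic identity reduces to an
    equality of index maps on 0, ..., q, which is linear arithmetic. *)
Lemma reindexes_eq q r (f f' : C q -> C r) e e' : reindexes f e -> reindexes f' e' ->
  (forall k, (k <= q)%N -> e k = e' k) -> forall x, f x = f' x.
Proof.
move=> fe fe' ee x; apply: homog_ext => A gam.
rewrite (fe A gam x) (fe' A gam x); apply: eq_homog => k kq.
by rewrite ee.
Qed.

Lemma reindexes_comp q r p (f : C r -> C p) (g : C q -> C r) e e' :
  reindexes f e -> reindexes g e' -> reindexes (fun x => f (g x)) (fun k => e (e' k)).
Proof. by move=> fe ge A gam x; rewrite (fe A gam) (ge A). Qed.

Lemma reindexes_id q : reindexes (@id (C q)) id.
Proof. by []. Qed.

Lemma reindexes_cof q i : (i <= q.+1)%N -> reindexes (@cof q i) (bump i).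
Proof. by move=> iq A gam x; have := homog_coface (inord i) x gam; rewrite inordK. Qed.

Lemma reindexes_cod q j : (j <= q)%N -> reindexes (@cod q j) (unbump j).
Proof. by move=> iq A gam x; have := homog_codegen (inord j) x gam; rewrite inordK. Qed.

Lemma reindexes_cyc q : reindexes (@cyc _ _ _ _ q) (cycidx q).
Proof. by move=> A gam x; exact: homog_cyc. Qed.

Lemma cycidxE q k : cycidx q k = if k == 0 then q else k.-1.
Proof. by case: k. Qed.

Lemma reindexes_iter q n (f : C q -> C q) e :
  reindexes f e -> reindexes (iter n f) (iter n e).
Proof.
move=> fe; elim: n => [|n IHn]; first exact: reindexes_id.
exact: reindexes_comp fe IHn.
Qed.

Lemma cof_cof q i j (x : C q) : (i <= j)%N -> (j <= q.+1)%N ->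
  cof j.+1 (cof i x) = cof i (cof j x).
Proof.
move=> h0 h1; apply: (reindexes_eq (f := fun x => cof j.+1 (cof i x)) (f' := fun x => cof i (cof j x)) (reindexes_comp (reindexes_cof (i := j.+1) _) (reindexes_cof (i := i) _)) (reindexes_comp (reindexes_cof (i := i) _) (reindexes_cof (i := j) _))) x.
all: try lia.
by move=> k kq; rewrite /bump /unbump; lia.
Qed.

Lemma cod_cof_lt q i j (x : C q.+1) : (i <= j)%N -> (j <= q)%N ->
  cod j.+1 (cof i x) = cof i (cod j x).
Proof.
move=> h0 h1; apply: (reindexes_eq (f := fun x => cod j.+1 (cof i x)) (f' := fun x => cof i (cod j x)) (reindexes_comp (reindexes_cod (j := j.+1) _) (reindexes_cof (i := i) _)) (reindexes_comp (reindexes_cof (i := i) _) (reindexes_cod (j := j) _))) x.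
all: try lia.
by move=> k kq; rewrite /bump /unbump; lia.
Qed.

Lemma cod_cof_eq q j (x : C q) : (j <= q)%N ->
  cod j (cof j x) = x.
Proof.
move=> h0; apply: (reindexes_eq (f := fun x => cod j (cof j x)) (f' := fun x => x) (reindexes_comp (reindexes_cod (j := j) _) (reindexes_cof (i := j) _)) (reindexes_id (q := q))) x.
all: try lia.
by move=> k kq; rewrite /bump /unbump; lia.
Qed.

Lemma cod_cof_eqS q j (x : C q) : (j <= q)%N ->
  cod j (cof j.+1 x) = x.
Proof.
move=> h0; apply: (reindexes_eq (f := fun x => cod j (cof j.+1 x)) (f' := fun x => x) (reindexes_comp (reindexes_cod (j := j) _) (reindexes_cof (i := j.+1) _)) (reindexes_id (q := q))) x.
all: try lia.
by move=> k kq; rewrite /bump /unbump; lia.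
Qed.

Lemma cod_cof_gt q i j (x : C q.+1) : (j < i)%N -> (i <= q.+1)%N ->
  cod j (cof i.+1 x) = cof i (cod j x).
Proof.
move=> h0 h1; apply: (reindexes_eq (f := fun x => cod j (cof i.+1 x)) (f' := fun x => cof i (cod j x)) (reindexes_comp (reindexes_cod (j := j) _) (reindexes_cof (i := i.+1) _)) (reindexes_comp (reindexes_cof (i := i) _) (reindexes_cod (j := j) _))) x.
all: try lia.
by move=> k kq; rewrite /bump /unbump; lia.
Qed.

Lemma cod_cod q i j (x : C q.+2) : (i <= j)%N -> (j <= q)%N ->
  cod j (cod i x) = cod i (cod j.+1 x).
Proof.
move=> h0 h1; apply: (reindexes_eq (f := fun x => cod j (cod i x)) (f' := fun x => cod i (cod j.+1 x)) (reindexes_comp (reindexes_cod (j := j) _) (reindexes_cod (j := i) _)) (reindexes_comp (reindexes_cod (j := i) _) (reindexes_cod (j := j.+1) _))) x.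
all: try lia.
by move=> k kq; rewrite /bump /unbump; lia.
Qed.

Lemma cyc_cof q i (x : C q) : (i <= q)%N ->
  cyc (cof i.+1 x) = cof i (cyc x).
Proof.
move=> h0; apply: (reindexes_eq (f := fun x => cyc (cof i.+1 x)) (f' := fun x => cof i (cyc x)) (reindexes_comp (reindexes_cyc (q := _)) (reindexes_cof (i := i.+1) _)) (reindexes_comp (reindexes_cof (i := i) _) (reindexes_cyc (q := _)))) x.
all: try lia.
by move=> k kq; rewrite !cycidxE /bump /unbump; do ?case: eqP; lia.
Qed.

Lemma cyc_cof0 q (x : C q) : 
  cyc (cof 0 x) = cof q.+1 x.
Proof.
apply: (reindexes_eq (f := fun x => cyc (cof 0 x)) (f' := fun x => cof q.+1 x) (reindexes_comp (reindexes_cyc (q := _)) (reindexes_cof (i := 0) _)) (reindexes_cof (i := q.+1) _)) x.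
all: try lia.
by move=> k kq; rewrite !cycidxE /bump /unbump; do ?case: eqP; lia.
Qed.

Lemma cod_cyc q j (x : C q.+1) : (j < q)%N ->
  cod j (cyc x) = cyc (cod j.+1 x).
Proof.
move=> h0; apply: (reindexes_eq (f := fun x => cod j (cyc x)) (f' := fun x => cyc (cod j.+1 x)) (reindexes_comp (reindexes_cod (j := j) _) (reindexes_cyc (q := _))) (reindexes_comp (reindexes_cyc (q := _)) (reindexes_cod (j := j.+1) _))) x.
all: try lia.
by move=> k kq; rewrite !cycidxE /bump /unbump; do ?case: eqP; lia.
Qed.

Lemma cod_cyc_cyc q (x : C q.+1) : 
  cod q (cyc (cyc x)) = cyc (cod 0 x).
Proof.
apply: (reindexes_eq (f := fun x => cod q (cyc (cyc x))) (f' := fun x => cyc (cod 0 x)) (reindexes_comp (reindexes_cod (j := q) _) (reindexes_comp (reindexes_cyc (q := _)) (reindexes_cyc (q := _)))) (reindexes_comp (reindexes_cyc (q := _)) (reindexes_cod (j := 0) _))) x.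
all: try lia.
by move=> k kq; rewrite !cycidxE /bump /unbump; do ?case: eqP; lia.
Qed.

Lemma iter_cycidx q n k : (n + k <= q)%N -> iter n (cycidx q) (n + k)%N = k.
Proof. by elim: n => // n IHn nk; rewrite iterSr addSn IHn // ltnW. Qed.

Lemma cyc_order q (x : C q) : iter q.+1 (@cyc _ _ _ _ q) x = x.
Proof.
apply: (reindexes_eq (reindexes_iter _ (reindexes_cyc (q := q))) (reindexes_id (q := q))) x.
(* The index k reaches 0 after k steps, jumps to q in one more, and comes back to k after the
   remaining q - k. *)
move=> k kq; have -> : q.+1 = ((q - k) + (1 + k))%N by lia.
rewrite iterD (iterD 1) -{3}[k]addn0 iter_cycidx ?addn0 //=.
by have := @iter_cycidx q (q - k) k; rewrite subnK // => ->.
Qed.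

End HopfCocyclic.

Lemma inord_max q : inord q = ord_max :> 'I_q.+1.
Proof. by apply: val_inj; rewrite /= inordK. Qed.

(** * The mixed complex of Hopf-cyclic cochains *)

Section ConnesOperator.
Variables (K : fieldType) (F : comAlgType K) (H : hopf F) (V : comodule H).
Local Notation C := (fun q => mtens V F q : lmodType K).
Local Notation cofl := (@cof_linear K F H V).
Local Notation codl := (@cod_linear K F H V).
Local Notation cycl := (@cyc_is_linear K F H V).
Local Notation cofcof := (@cof_cof K F H V).
Local Notation cc_lt := (@cod_cof_lt K F H V).
Local Notation cc_eq := (@cod_cof_eq K F H V).
Local Notation cc_eqS := (@cod_cof_eqS K F H V).
Local Notation cc_gt := (@cod_cof_gt K F H V).
Local Notation codcod := (@cod_cod K F H V).
Local Notation cyccof := (@cyc_cof K F H V).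
Local Notation cyccof0 := (@cyc_cof0 K F H V).
Local Notation codcyc := (@cod_cyc K F H V).
Local Notation codcyccyc := (@cod_cyc_cyc K F H V).
Local Notation cycord := (@cyc_order K F H V).
Local Notation face := (@cof K F H V : forall q, nat -> C q -> C q.+1).
Local Notation degen := (@cod K F H V : forall q, nat -> C q.+1 -> C q).
Local Notation cycle := (@cyc K F H V : forall q, C q -> C q).

Lemma hoch_dE q (x : C q) : hoch_d x = @cob K C face q x.
Proof.
rewrite /hoch_d /cob big_mkord; apply: eq_bigr => i _.
by rewrite /cof inord_val.
Qed.

Lemma connesE q (x : C q.+1) : connes x = @boundary K C degen cycle q x.
Proof.
rewrite /connes /boundary /cycnorm big_mkord; apply: eq_bigr => i _.
apply: etrans _ (esym (@iter_lam K C cycle cycl q i _)).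
by rewrite /xdeg /cod inord_max.
Qed.

Lemma normalizedE q (x : C q) : x \in normalized V q <-> @nondeg K C degen q x.
Proof.
split=> [/mk_subspaceP|nx].
  case: q x => // q x nx; apply/nondegS => j jq; exact: nx.
apply/mk_subspaceP; case: q x nx => // q x /nondegS nx j.
by have := nx j (leq_ord j); rewrite /cod inord_val.
Qed.

Lemma hoch_d_hoch_d q (x : C q) : hoch_d (hoch_d x) = 0.
Proof. by rewrite !hoch_dE; exact: (cob_cob cofl cofcof). Qed.

Lemma normalized_hoch_d q (x : C q) :
  x \in normalized V q -> hoch_d x \in normalized V q.+1.
Proof.
move/normalizedE => nx; apply/normalizedE; rewrite hoch_dE.
exact: (nondeg_cob cofl codl cc_lt cc_eq cc_eqS cc_gt).
Qed.

Lemma normalized_connes q (x : C q.+1) :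
  x \in normalized V q.+1 -> connes x \in normalized V q.
Proof.
move/normalizedE => nx; apply/normalizedE; rewrite connesE.
exact: (boundary_nondeg codl cycl codcod codcyc codcyccyc).
Qed.

Lemma connes_connes q (x : C q.+2) :
  x \in normalized V q.+2 -> connes (connes x) = 0.
Proof.
move/normalizedE => nx; rewrite !connesE.
exact: (boundary_boundary codl cycl codcod codcyc codcyccyc).
Qed.

Lemma connes_hoch_d q (x : C q.+1) :
  x \in normalized V q.+1 -> connes (hoch_d x) = - hoch_d (connes x).
Proof.
move/normalizedE => nx; rewrite !connesE !hoch_dE.
exact: (boundary_cob cofl codl cycl cc_lt cc_eq cc_eqS cc_gt cyccof cyccof0 codcyccyc cycord).
Qed.

Lemma connes_hoch_d0 (x : C 0) : connes (hoch_d x) = 0.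
Proof.
rewrite connesE hoch_dE.
exact: (boundary_cob0 codl cycl cc_eq cc_eqS cyccof cyccof0 cycord).
Qed.

Lemma hoch_normalization q (x : C q.+1) : hoch_d x \in normalized V q.+2 ->
  exists z : C q, x - hoch_d z \in normalized V q.+1.
Proof.
move/normalizedE; rewrite hoch_dE => nx.
have [z nz] := normalization cofl codl cofcof cc_lt cc_eq cc_eqS cc_gt codcod nx.
by exists z; apply/normalizedE; rewrite hoch_dE.
Qed.

(** Each summand of the Connes operator is normalized, not only their sum; this allows the effect of
    a rotation on evaluations to be applied summand by summand. *)
Lemma normalized_iter_cyc q (x : C q.+2) i : x \in normalized V q.+2 ->
  iter i (@cyc _ _ _ _ q.+1) (codegen ord_max (cyc x)) \in normalized V q.+1.
Proof.
move/normalizedE => nx; apply/normalizedE/nondegS => j jq.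
have := xdeg_iter_nondeg codl cycl codcod codcyc codcyccyc i nx jq.
by rewrite /xdeg /cod inord_max.
Qed.

End ConnesOperator.

(** * Normalized cochains and the pairing *)

Lemma fins_same (T : Type) q (i : 'I_q.+1) (x : T) f : fins i x f i = x.
Proof. by rewrite ffunE unlift_none. Qed.

Lemma fins_lift (T : Type) q (i : 'I_q.+1) (x : T) f j : fins i x f (lift i j) = f j.
Proof. by rewrite ffunE liftK. Qed.

Section AugmentationIdeal.
Variables (K : fieldType) (F : comAlgType K) (H : hopf F) (V : comodule H).
Local Notation C q := (mtens V F q).

Definition insert1 q (j : 'I_q.+1) : C q -> C q.+1 :=
  mlift (fun v f => mpure v (fins j 1 f)).

Lemma insert1_multilin q (j : 'I_q.+1) :
  multilin (fun (v : V) (f : {ffun 'I_q -> F}) => mpure v (fins j 1 f)).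
Proof.
have [m1 m2] := mpure_multilin V F q.+1; split=> [f|v i f] a x y; first exact: m1.
by rewrite !fins_upd m2.
Qed.

Lemma insert1_linear q (j : 'I_q.+1) : linear (@insert1 q j).
Proof. exact: mlift_linear (insert1_multilin j). Qed.

Definition reduce q (j : 'I_q) : C q -> C q :=
  match q return 'I_q -> C q -> C q with
  | 0 => fun=> id
  | q'.+1 => fun j x => x - insert1 j (codegen j x)
  end j.

Lemma reduce_linear q (j : 'I_q) : linear (reduce j).
Proof.
case: q j => [|q] j a x y //=.
rewrite (codegen_is_linear j) (@insert1_linear _ j).
by rewrite opprD scalerBr addrACA.
Qed.

Lemma reduce_pure q (j : 'I_q) v f :
  reduce j (mpure v f) = mpure v (fupd j (f j - (counit H (f j))%:A) f).
Proof.
case: q j f => [[m lt_m0]|q j f]; first by case: (notF lt_m0).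
have m2 := (mpure_multilin V F q.+1).2 v j f.
rewrite /= /codegen (mlift_pure (@codegen_multilin _ _ H V q j)) /codegen_fun.
rewrite (linear_funZ (@insert1_linear _ j)).
rewrite /insert1 (mlift_pure (insert1_multilin j)).
have -> : fins j 1 (fdel j f) = fupd j 1 f.
  by apply/ffunP => k; rewrite !ffunE; case: unliftP => [i ->|->] /=;
    rewrite ?ffunE ?eqxx // eq_sym (negPf (neq_lift _ _)).
have e : fupd j (f j) f = f.
  by apply/ffunP => k; rewrite ffunE; case: eqP => // ->.
by rewrite (linear_funB m2) (linear_funZ m2) e.
Qed.

Lemma reduce_normalized q (j : 'I_q) (x : C q) : x \in normalized V q -> reduce j x = x.
Proof.
case: q j x => // q j x /mk_subspaceP nx.
by rewrite /= (nx j) (linear_fun0 (@insert1_linear _ j)) subr0.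
Qed.

(* A normalized cochain is a sum of pure tensors with all entries in the
   augmentation ideal. *)
Lemma normalized_ind q (N : lmodType K) (L : C q -> N) : linear L ->
    (forall v (f : {ffun 'I_q -> F}),
       (forall i, counit H (f i) = 0) -> L (mpure v f) = 0) ->
  forall x, x \in normalized V q -> L x = 0.
Proof.
move=> lL L0 x nx; pose R (js : seq 'I_q) y := foldr (@reduce q) y js.
have RE js : R js x = x by elim: js => //= j js ->; exact: reduce_normalized.
have lR js : linear (R js).
  by elim: js => [//|j js IHj] a y z; rewrite /= IHj (reduce_linear j).
have Rpure js v f : exists2 f', R js (mpure v f) = mpure v f' &
    forall j, j \in js -> counit H (f' j) = 0.
  elim: js => [|j js [f' e f0]] /=; first by exists f.
  exists (fupd j (f' j - (counit H (f' j))%:A) f'); first by rewrite e reduce_pure.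
  move=> k; rewrite inE ffunE; case: eqP => [-> _|_] /=; last exact: f0.
  have lc : linear (counit H : F -> K^o) := linearP _.
  by rewrite (linear_funB lc) (linear_funZ lc) counit1 [_ *: _]mulr1 subrr.
rewrite -(RE (enum 'I_q)).
have l0 : linear (fun _ : C q => 0 : N) by move=> a y z; rewrite scaler0 addr0.
apply: (mtens_ext (L1 := fun y => L (R _ y)) (L2 := fun=> 0) _ l0) => [|v f].
  exact: linear_comp lL (lR _).
have [f' -> f0] := Rpure (enum 'I_q) v f.
by apply: L0 => i; apply: f0; rewrite mem_enum.
Qed.

Definition feval_fun q (b : 'I_q -> F -> K) (v : V) (f : {ffun 'I_q -> F}) : V :=
  (\prod_(i < q) b i (f i)) *: v.

Definition feval q (b : 'I_q -> F -> K) : C q -> V := mlift (feval_fun b).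

Lemma feval_multilin q (b : 'I_q -> F -> K) :
  (forall i, scalar (b i)) -> multilin (feval_fun b).
Proof.
move=> lb; split=> [f|v i f] a x y; first by rewrite /feval_fun scalerDr !scalerA mulrC.
by rewrite /feval_fun !prod_fupd lb mulrDl scalerDl -mulrA -scalerA.
Qed.

Lemma feval_linear q (b : 'I_q -> F -> K) : (forall i, scalar (b i)) -> linear (feval b).
Proof. by move=> lb; exact: mlift_linear (feval_multilin lb). Qed.

Lemma feval_pure q (b : 'I_q -> F -> K) v f : (forall i, scalar (b i)) ->
  feval b (mpure v f) = (\prod_(i < q) b i (f i)) *: v.
Proof. by move=> lb; exact: mlift_pure (feval_multilin lb) _ _. Qed.

Lemma counit_scalar : scalar (counit H).
Proof. exact: linearP. Qed.

Lemma sweedler0 (N : lmodType K) (phi : {ffun 'I_0 -> F} -> N) x :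
  sweedler H phi x = counit H x *: phi [ffun=> 0].
Proof. by []. Qed.

Lemma sweedlerS n (N : lmodType K) (phi : {ffun 'I_n.+1 -> F} -> N) x :
  sweedler H phi x
  = \sw_(a, b <- comul H x) sweedler H (fun s => phi (fins ord0 a s)) b.
Proof. by []. Qed.

Lemma sweedler_counit n (N : lmodType K) (al : F -> N) x : linear al ->
  sweedler H (fun s : {ffun 'I_n.+1 -> F} =>
    (\prod_(j < n) counit H (s (lift ord_max j))) *: al (s ord_max)) x = al x.
Proof.
move=> lal; elim: n x => [|n IHn] x.
  rewrite sweedlerS -[RHS](conv_counitr H x lal); apply: eq_tlift => a b.
  rewrite sweedler0.
  by rewrite big_ord0 scale1r (_ : ord_max = ord0) ?fins_same //; exact: val_inj.
rewrite sweedlerS -[RHS](conv_counitl H x lal); apply: eq_tlift => a b.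
rewrite -[in RHS](IHn b) (lin_sweedler _ (linear_scale (counit H a) (@id_linear K N))).
apply: eq_sweedler => s; rewrite scalerA big_ord_recl.
rewrite (eq_bigr (fun j => counit H (s (lift ord_max j)))) => [|j _]; last first.
  have -> : lift ord_max (lift ord0 j) = lift ord0 (lift ord_max j) :> 'I_n.+2.
    by apply/ord_inj; rewrite lift_max !lift0 lift_max.
  by rewrite fins_lift.
have -> : lift ord_max ord0 = ord0 :> 'I_n.+2 by apply: val_inj.
have -> : ord_max = lift ord0 ord_max :> 'I_n.+2 by apply: val_inj.
by rewrite fins_same fins_lift.
Qed.

(* The hypotheses on b hold for derivations at the counit, the last of which may
   be replaced by the counit itself. *)
Lemma feval_cyc q (b : 'I_q.+1 -> F -> K) (c : F -> K) v (f : {ffun 'I_q.+1 -> F}) :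
    (forall i, scalar (b i)) ->
    (forall j x y, counit H y = 0 ->
       b (lift ord_max j) (x * y) = counit H x * b (lift ord_max j) y) ->
    (forall x y, b ord_max (x * y) = b ord_max x * counit H y + counit H x * c y) ->
    (forall i, counit H (f i) = 0) ->
  feval b (cyc (mpure v f))
  = (b ord_max (antip H (f ord0)) * \prod_(j < q) b (lift ord_max j) (f (lift ord0 j))) *: v.
Proof.
move=> lb bM bmax f0; set r := \prod_(j < q) _.
rewrite /cyc (mlift_pure (@cyc_multilin _ _ H V q)) /cyc_fun.
rewrite (lin_tlift (feval_linear lb)).
transitivity (\sw_(a, w <- coact V v) (counit H a *: ((b ord_max (antip H (f ord0)) * r) *: w))).
  apply: eq_tlift => a w; rewrite (lin_sweedler _ (feval_linear lb)).
  (* By [bM] every slot but the last reduces to a counit times its own factor, and [sweedler_counit]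
     absorbs these counits; [al] is what remains in the last slot. *)
  pose al x : V := (b ord_max x * counit H a + counit H x * c a) *: (r *: w).
  have lal : linear al.
    move=> k x y; rewrite /al lb counit_scalar [RHS]addrC !scalerA -scalerDl addrC.
    by congr (_ *: _); ring.
  transitivity (al (antip H (f ord0))).
    rewrite -[RHS](sweedler_counit q _ lal); apply: eq_sweedler => s.
    rewrite (feval_pure _ _ lb) (prodD1_ord ord_max) ffunE fins_same bmax.
    rewrite /al !scalerA mulrCA; congr (_ * _ *: w).
    rewrite -big_split; apply: eq_bigr => j _.
    by rewrite /= ffunE fins_lift ffunE bM.
  (* The term with [c] dies because eps(S(f^1)) = eps(f^1) = 0. The coaction then enters only
     through its counit, which [coact1] removes. *)
  by rewrite /al counit_antip f0 mul0r addr0 !scalerA mulrA (mulrC (counit H a)).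
rewrite -[in RHS](coact1 v) (lin_tlift (linear_scale _ (@id_linear K V))).
by apply: eq_tlift => a w; rewrite !scalerA mulrC.
Qed.

End AugmentationIdeal.

Lemma mlift_phi_sum (K : fieldType) (V F N : lmodType K) q I (r : seq I) (a : I -> K)
    (phi : I -> V -> {ffun 'I_q -> F} -> N) (t : mtens V F q) :
  mlift (fun v f => \sum_(i <- r) a i *: phi i v f) t
  = \sum_(i <- r) a i *: mlift (phi i) t.
Proof.
elim: r => [|i r IHr].
  rewrite [RHS]big_nil.
  have e := mlift_phi_linear (-1) (fun _ _ => 0 : N) (fun _ _ => 0) t.
  apply: etrans (etrans e _); last by rewrite scaleN1r addNr.
  by apply: eq_mlift => v f; rewrite big_nil scaler0 addr0.
rewrite big_cons -IHr -mlift_phi_linear.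
by apply: eq_mlift => v f; rewrite big_cons.
Qed.

(** * Lie algebra elements as derivations at the counit *)

Section Pairing.
Variables (K : fieldType) (F : comAlgType K) (HF : hopf F) (g : lieAlg K)
  (U : enveloping g) (P : hopf_pairing HF (env_hopf U)) (V : comodule HF).
Local Notation C q := (mtens V F q).
Local Notation "<< f , X >>" := (P f (env_inj U X)) (at level 0).
Local Notation eps := (counit HF).

Lemma pairing_primM a b X : << a * b, X >> = << a, X >> * eps b + eps a * << b, X >>.
Proof.
rewrite pairingMl env_comul.
have bP : bilin (fun x y => P a x * P b y : K^o).
  split=> [y|x] k u w; first by rewrite pairing_linr mulrDl scalerAl.
  by rewrite pairing_linr mulrDr scalerAr.
by rewrite (linear_funD (tlift_linear bP)) !(tlift_pure bP) !pairing1r.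
Qed.

Lemma pairing_prim1 X : << 1, X >> = 0.
Proof.
have := pairing_primM 1 1 X; rewrite counit1 !mulr1 mul1r => e.
by apply: (addrI << 1, X >>); rewrite -e addr0.
Qed.

Lemma pairing_prim_linear X : linear (fun f => << f, X >> : K^o).
Proof. exact: pairing_linl. Qed.

(** A derivation at the counit kills 1; applied to S(f_(1)) f_(2) = eps(f) 1 it makes the two
    pairings sum to zero. *)
Lemma pairing_prim_antip f X : << antip HF f, X >> = - << f, X >>.
Proof.
have lP := pairing_prim_linear X.
apply/eqP; rewrite -addr_eq0; apply/eqP.
have := congr1 (fun f => << f, X >> : K^o) (antipl HF f).
rewrite (lin_tlift lP) (linear_funZ lP) pairing_prim1 scaler0 => <-.
rewrite -[<< antip HF f, X >>](conv_counitr HF f (linear_comp lP (antip_linear HF))).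
rewrite -[<< f, X >>](conv_counitl HF f lP).
have := tlift_phi_linear 1 (fun a b => eps b *: (<< antip HF a, X >> : K^o))
  (fun a b => eps a *: (<< b, X >> : K^o)) (comul HF f).
rewrite scale1r => <-; apply: (@eq_tlift _ _ _ K^o) => a b.
by rewrite pairing_primM counit_antip scale1r mulrC.
Qed.

Definition eval_at q (Y : 'I_q -> g) : C q -> V := feval (fun i f => << f, Y i >>).

Lemma eval_at_linear q (Y : 'I_q -> g) : linear (@eval_at q Y).
Proof. by apply: feval_linear => i; exact: pairing_linl. Qed.

(** The codegeneracy amounts to the counit in the last slot, where the rotation has put S(f^1); on
    normalized cochains this gives the factor eps(S(f^1)) = 0. *)
Lemma eval_at_xdeg q (Y : 'I_q -> g) (x : C q.+1) : x \in normalized V q.+1 ->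
  eval_at Y (codegen ord_max (cyc x)) = 0.
Proof.
pose b (i : 'I_q.+1) f := if unlift ord_max i is Some j then << f, Y j >> else eps f.
have lb i : scalar (b i).
  by rewrite /b; case: unlift => [j|]; [exact: pairing_linl | exact: counit_scalar].
have bmax f : b ord_max f = eps f by rewrite /b unlift_none.
have blift j f : b (lift ord_max j) f = << f, Y j >> by rewrite /b liftK.
have E : forall y : C q.+1, eval_at Y (codegen ord_max y) = feval b y.
  apply: mtens_ext => [||v f].
  - exact: linear_comp (@eval_at_linear q Y) (codegen_is_linear ord_max).
  - exact: feval_linear.
  rewrite /codegen (mlift_pure (@codegen_multilin _ _ HF V q ord_max)) /codegen_fun.
  rewrite (linear_funZ (@eval_at_linear q Y)) /eval_at !feval_pure // => [|i]; last first.
    exact: pairing_linl.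
  rewrite (prodD1_ord ord_max) bmax scalerA; congr (_ * _ *: _); apply: eq_bigr => j _.
  by rewrite blift ffunE.
rewrite E; move: x; apply: normalized_ind => [|v f f0].
  exact: linear_comp (feval_linear lb) (@cyc_is_linear _ _ HF V q.+1).
rewrite (feval_cyc (c := fun=> 0) v lb) //.
- by rewrite bmax counit_antip f0 mul0r scale0r.
- by move=> j u w w0; rewrite !blift pairing_primM w0 mulr0 add0r.
- by move=> u w; rewrite !bmax counitM mulr0 addr0.
Qed.

(** The rotation carries the first entry, under the antipode, to the last slot; the antipode
    accounts for the sign. *)
Lemma eval_at_cyc q (Y : 'I_q.+1 -> g) (x : C q.+1) : x \in normalized V q.+1 ->
  eval_at Y (cyc x)
  = - eval_at (fun i => if unlift ord0 i is Some j then Y (lift ord_max j)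
                        else Y ord_max) x.
Proof.
set Y' := fun i => _; move=> nx; apply/eqP; rewrite -addr_eq0; apply/eqP.
move: x nx; apply: normalized_ind => [|v f f0].
  apply: linear_add (@eval_at_linear _ Y').
  exact: linear_comp (@eval_at_linear _ Y) (@cyc_is_linear _ _ HF V q.+1).
have lY (Z : 'I_q.+1 -> g) i : scalar (fun f => << f, Z i >>) by exact: pairing_linl.
rewrite {1}/eval_at (feval_cyc (c := fun f => << f, Y ord_max >>) v (lY Y)) //.
- rewrite pairing_prim_antip /eval_at (feval_pure _ _ (lY Y')) -scalerDl.
  rewrite (prodD1_ord ord0) /Y' unlift_none mulNr.
  rewrite [X in - (_ * X)](eq_bigr (fun j => << f (lift ord0 j), Y' (lift ord0 j) >>)).
    by rewrite addNr scale0r.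
  by move=> j _; rewrite /Y' liftK.
- by move=> j u w w0; rewrite pairing_primM w0 mulr0 add0r.
- by move=> u w; rewrite pairing_primM.
Qed.

(** Every summand vanishes separately, for every tuple [Y]: the unrotated one by [eval_at_xdeg], the
    others because a rotation permutes [Y] up to sign. *)
Lemma eval_at_connes q (Y : 'I_q -> g) (x : C q.+1) : x \in normalized V q.+1 ->
  eval_at Y (connes x) = 0.
Proof.
move=> nx; rewrite /connes (linear_fun_sum (@eval_at_linear q Y)) big1 // => i _.
rewrite (linear_funZ (@eval_at_linear q Y)).
suff -> : eval_at Y (iter i (@cyc _ _ _ _ q) (codegen ord_max (cyc x))) = 0.
  by rewrite scaler0.
elim: (nat_of_ord i) Y => [|n IHn] Y; first exact: eval_at_xdeg.
(* In degree 0 the rotation is the identity. *)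
case: q x nx Y IHn {i} => [|q] x nx Y IHn; first exact: IHn.
by rewrite iterS eval_at_cyc ?IHn ?oppr0 //; exact: normalized_iter_cyc.
Qed.

Lemma antisym_eval_at (h l : {vspace g}) q (x : C q) (xi : {ffun 'I_q -> g}) :
  mlift (@antisym_fun _ _ _ _ _ P V h l q) x xi
  = \sum_(s : 'S_q) (-1) ^+ s *: eval_at (fun i => daddv_pi l h (xi (s i))) x.
Proof.
rewrite (@lin_mlift _ _ _ _ _ _ (fun phi : cochain g V q => phi xi)) //.
rewrite -mlift_phi_sum; apply: eq_mlift => v f; rewrite /antisym_fun scaler_suml.
by apply: eq_bigr => s _; rewrite /feval_fun scalerA.
Qed.

Lemma antisym_connes (h l : {vspace g}) q (x : C q.+1) : x \in normalized V q.+1 ->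
  mlift (@antisym_fun _ _ _ _ _ P V h l q) (connes x) = 0.
Proof.
move=> nx; apply/funext => xi; rewrite antisym_eval_at big1 // => s _.
by rewrite eval_at_connes // scaler0.
Qed.

End Pairing.

(** * Subquotients *)

Section SubquotientMaps.
Variables (K : fieldType) (M : lmodType K) (Z B : subspace M).

Lemma class_of_linear : linear (@class_of _ _ Z B).
Proof. exact: qpi_is_linear. Qed.

Lemma class_of_eq0 (z : subm Z) : class_of B z = 0 <-> val z \in B.
Proof.
have e0 : class_of B 0 = 0 := linear_fun0 class_of_linear.
split=> [e|zB].
  have /eqP : class_of B z = class_of B 0 by rewrite e0.
  by rewrite /class_of qpi_eq subr0 => /mk_subspaceP.
rewrite -e0; apply/eqP; rewrite /class_of qpi_eq subr0.
exact/mk_subspaceP.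
Qed.

Lemma class_of_eq (z z' : subm Z) : class_of B z = class_of B z' <-> val z - val z' \in B.
Proof.
rewrite -raddfB -class_of_eq0 (linear_funB class_of_linear).
by split=> [->|/eqP]; rewrite ?subrr // subr_eq0 => /eqP.
Qed.

Lemma class_ofP (c : subquot Z B) : exists z : subm Z, class_of B z = c.
Proof. by exists (repr c); exact: qpiK. Qed.

(** Total on the ambient space, with the zero class outside [Z], so that families of classes can be
    written without carrying membership proofs. *)
Definition class_at (y : M) : subquot Z B := class_of B (insubd (0 : subm Z) y).

Lemma class_atE (z : subm Z) : class_at (val z) = class_of B z.
Proof. by rewrite /class_at valKd. Qed.

Lemma class_at_linear a x y : x \in Z -> y \in Z ->
  class_at (a *: x + y) = a *: class_at x + class_at y.
Proof.
move=> xZ yZ; rewrite -[x]/(val (SubM xZ)) -[y]/(val (SubM yZ)) -linearP !class_atE.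
exact: class_of_linear.
Qed.

Lemma class_at_eq0 y : y \in Z -> class_at y = 0 <-> y \in B.
Proof. by move=> yZ; rewrite -[y]/(val (SubM yZ)) class_atE; exact: class_of_eq0. Qed.

Lemma class_at_eq x y : x \in Z -> y \in Z -> x - y \in B -> class_at x = class_at y.
Proof.
move=> xZ yZ; rewrite -[x]/(val (SubM xZ)) -[y]/(val (SubM yZ)) !class_atE => e.
exact/class_of_eq.
Qed.

Lemma has_class_at y : y \in Z -> has_class (class_at y) y.
Proof. by move=> yZ; exists (SubM yZ); split=> //; rewrite -class_atE. Qed.

(** The first isomorphism theorem; the inverse picks preimages by choice. *)
Lemma subquot_iso (N : lmodType K) (G : subm Z -> N) : linear G ->
    (forall z, G z = 0 <-> val z \in B) -> (forall n, exists z, G z = n) ->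
  exists Theta : {linear subquot Z B -> N},
    bijective Theta /\ forall z, Theta (class_of B z) = G z.
Proof.
move=> lG G0 Gsurj; pose T (c : subquot Z B) : N := G (repr c).
have TE z : T (class_of B z) = G z.
  apply/eqP; rewrite -subr_eq0 -(linear_funB lG); apply/eqP/G0.
  by rewrite raddfB; apply/class_of_eq; exact: qpiK.
have lT : linear T.
  move=> a c c'; have [z <-] := class_ofP c; have [z' <-] := class_ofP c'.
  by rewrite -class_of_linear !TE lG.
pose L : {linear subquot Z B -> N} := HB.pack T (GRing.isLinear.Build _ _ _ _ T lT).
exists L; split=> //.
pose S (n : N) : subquot Z B := class_of B (projT1 (cid (Gsurj n))).
have TS : cancel S T by move=> n; rewrite /S TE; case: cid.
exists S => // c; have [z <-] := class_ofP c.
have : T (S (T (class_of B z)) - class_of B z) = 0.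
  by rewrite (linear_funB lT) TS subrr.
rewrite /S -(linear_funB class_of_linear) TE => /G0/class_of_eq0.
by rewrite (linear_funB class_of_linear) => /eqP; rewrite subr_eq0 => /eqP.
Qed.

End SubquotientMaps.

Section InducedIsomorphism.
Variables (K : fieldType) (M N : lmodType K) (Z B : subspace M) (Z' B' : subspace N).
Variable f : M -> N.
Hypothesis f_iso : induces_iso Z B Z' B' f.

Lemma induces_iso_inj x : x \in Z -> f x \in B' -> x \in B.
Proof.
case: f_iso => T [[S TK SK] Tf] xZ fxB.
have /Tf [z [zE zc]] := has_class_at B xZ.
apply/(class_at_eq0 B xZ); rewrite -(TK (class_at Z B x)) -zc.
have -> : class_of B' z = 0 by apply/class_of_eq0; rewrite zE.
by rewrite -[in LHS](linear0 T) TK.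
Qed.

Lemma induces_iso_surj y : y \in Z' -> exists2 x, x \in Z & y - f x \in B'.
Proof.
case: f_iso => T [[S TK SK] Tf] yZ.
have [z zS] := class_ofP (S (class_at Z' B' y)).
have [|z' [zE zc]] := Tf (class_of B z) (val z); first by exists z.
exists (val z); first exact: valP.
by rewrite -zE -[y]/(val (SubM yZ)); apply/class_of_eq; rewrite zc zS SK -class_atE.
Qed.

End InducedIsomorphism.

(** * The periodic complex *)

Section PeriodicComplex.
Variables (K : fieldType) (F : comAlgType K) (H : hopf F) (V : comodule H).
Local Notation C q := (mtens V F q).
Local Notation fam := (gfamily (fun q => C q)).
Implicit Types x y : fam.

Lemma periodic_cochainsP p x : x \in periodic_cochains V p <->
  [/\ exists n, forall q, (n <= q)%N -> x q = 0,
      forall q, odd q != p -> x q = 0 & forall q, x q \in normalized V q].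
Proof. by split=> [/mk_subspaceP|h]; [|apply/mk_subspaceP]. Qed.

Lemma total_dS x q : total_d x q.+1 = hoch_d (x q) + connes (x q.+2).
Proof. by []. Qed.

Lemma total_d0 x : total_d x 0 = connes (x 1).
Proof. by []. Qed.

Lemma hoch_d0 q : hoch_d (0 : C q) = 0.
Proof. exact: raddf0. Qed.

Lemma connes0 q : connes (0 : C q.+1) = 0.
Proof. exact: raddf0. Qed.

Lemma total_d_normalized x q : (forall r, x r \in normalized V r) ->
  total_d x q \in normalized V q.
Proof.
move=> nx; case: q => [|q]; first exact: normalized_connes.
by rewrite total_dS rpredD ?normalized_hoch_d ?normalized_connes.
Qed.

Lemma total_d_total_d x : (forall r, x r \in normalized V r) -> total_d (total_d x) = 0.
Proof.
move=> nx; apply: functional_extensionality_dep => -[|[|q]].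
- rewrite total_d0 total_dS (linear_funD (@connes_is_linear _ _ H V _)).
  by rewrite connes_hoch_d0 connes_connes // addr0.
- rewrite !total_dS total_d0 (linear_funD (@connes_is_linear _ _ H V _)).
  by rewrite connes_hoch_d // connes_connes // addr0 subrr.
rewrite !total_dS (linear_funD (@connes_is_linear _ _ H V _)).
rewrite (linear_funD (@hoch_d_is_linear _ _ H V _)).
by rewrite hoch_d_hoch_d connes_hoch_d // connes_connes // add0r addr0 subrr.
Qed.

Lemma total_d_periodic p x : x \in periodic_cochains V p ->
  total_d x \in periodic_cochains V (~~ p).
Proof.
case/periodic_cochainsP => [[n xn] xp nx]; apply/periodic_cochainsP; split.
- exists n.+1 => -[//|q] nq; rewrite total_dS !xn ?hoch_d0 ?connes0 ?addr0 //.
  exact: leq_trans (nq : (n <= q)%N) (leqW (leqnSn q)).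
- case=> [|q] qp; first by rewrite total_d0 xp ?connes0 //; case: p qp {xp}.
  have qp' : odd q != p by case: p qp {xp} => /=; case: (odd q).
  by rewrite total_dS !xp /= ?negbK // hoch_d0 connes0 addr0.
- by move=> q; exact: total_d_normalized.
Qed.

Definition single n (z : C n) : fam := dfwith (fun q => 0 : C q) z.

Lemma single_same n (z : C n) : single z n = z.
Proof. exact: dfwith_in. Qed.

Lemma single_other n (z : C n) q : q != n -> single z q = 0.
Proof. by move=> qn; rewrite /single dfwith_out // eq_sym. Qed.

Lemma single_periodic n (z : C n) : z \in normalized V n ->
  single z \in periodic_cochains V (odd n).
Proof.
move=> nz; apply/periodic_cochainsP; split.
- by exists n.+1 => q nq; rewrite single_other // gtn_eqF.
- by move=> q qn; rewrite single_other //; apply: contraNneq qn => ->.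
move=> q; have [e|qn] := eqVneq q n; last by rewrite single_other ?rpred0.
by rewrite e single_same.
Qed.

Lemma total_d_single n (z : C n) q : q != n.+1 -> q.+1 != n -> total_d (single z) q = 0.
Proof.
case: q => [|q] qn qn1; first by rewrite total_d0 single_other ?connes0.
by rewrite total_dS !single_other ?hoch_d0 ?connes0 ?addr0.
Qed.

Lemma total_d_single_top n (z : C n) : total_d (single z) n.+1 = hoch_d z.
Proof.
by rewrite total_dS single_same single_other ?connes0 ?addr0 // gtn_eqF // leqW.
Qed.

Lemma total_d_single_bot n (z : C n.+1) : total_d (single z) n = connes z.
Proof.
case: n z => [|n] z; first by rewrite total_d0 single_same.
by rewrite total_dS single_same single_other ?hoch_d0 ?add0r // ltn_eqF // leqW.
Qed.

(** Exactness found in the full Hochschild complex is hereby brought back to normalized cochains. *)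
Lemma normalized_primitive q (y : C q) : hoch_d y \in normalized V q.+1 ->
  exists2 y', y' \in normalized V q & hoch_d y' = hoch_d y.
Proof.
case: q y => [|q] y ny; first by exists y => //; apply/mk_subspaceP.
have [z nz] := hoch_normalization ny; exists (y - hoch_d z); first exact: nz.
by rewrite (linear_funB (@hoch_d_is_linear _ _ H V _)) hoch_d_hoch_d subr0.
Qed.

Lemma cocycles_hochschild q (x : C q) : x \in cocycles (hochschild V) q <-> hoch_d x = 0.
Proof.
split=> [/mk_subspaceP[] //|dx]; apply/mk_subspaceP; split=> //.
exact/mk_subspaceP.
Qed.

Lemma coboundaries_hochschild q (x : C q.+1) :
  x \in coboundaries (hochschild V) q.+1 -> exists y : C q, x = hoch_d y.
Proof. by case/mk_subspaceP => y _ ->; exists y. Qed.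

End PeriodicComplex.

(** * Injectivity on periodic cohomology *)

Section Comparison.
Variables (K : fieldType) (F : comAlgType K) (HF : hopf F) (g : lieAlg K)
  (U : enveloping g) (P : hopf_pairing HF (env_hopf U)) (h l : {vspace g})
  (V : comodule HF).
Hypothesis theta_qi :
  @quasi_iso K (hochschild V) (rel_cpx P V h) (@theta _ _ _ _ _ P V h l).
Local Notation C q := (mtens V F q).
Local Notation fam := (gfamily (fun q => C q)).
Local Notation th := (@theta _ _ _ _ _ P V h l _).
Local Notation RZ q := (cocycles (rel_cpx P V h) q).
Local Notation RB q := (coboundaries (rel_cpx P V h) q).

Lemma in_full (M : lmodType K) (x : M) : x \in full_sub M.
Proof. exact/mk_subspaceP. Qed.

(** The projection [inv_proj] is selected by choice, so linearity is taken from the assumption that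
    theta is a cochain map. *)
Lemma theta_linear q : linear (@theta _ _ _ _ _ P V h l q).
Proof. by case: theta_qi => -[lin _ _] _ a x y; apply: lin; exact: in_full. Qed.

Lemma theta_hoch_d q (x : C q) : th (hoch_d x) = ce_d P (th x).
Proof. by case: theta_qi => -[_ _ e] _; apply: e; exact: in_full. Qed.

Lemma theta_rel q (x : C q) : th x \in rel_cochains P V h q.
Proof. by case: theta_qi => -[_ e _] _; apply: e; exact: in_full. Qed.

Lemma theta_connes q (x : C q.+1) : x \in normalized V q.+1 -> th (connes x) = 0.
Proof.
(* The value of the projection at 0 is never computed: both antisymmetrizations are 0, and theta 0 =
   0 by linearity. *)
move=> nx; rewrite -[RHS](linear_fun0 (@theta_linear q)) /theta antisym_connes //.
have e0 : mlift (@antisym_fun _ _ _ _ _ P V h l q) 0 = 0.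
  by have := @antisym_connes _ _ HF _ _ P V h l q 0 (rpred0 _); rewrite connes0.
by rewrite e0.
Qed.

Lemma theta_boundary q (x : C q) : th (hoch_d x) \in RB q.+1.
Proof.
by rewrite theta_hoch_d; apply/mk_subspaceP; exists (th x) => //; exact: theta_rel.
Qed.

Lemma theta_exact q (x : C q) : hoch_d x = 0 -> th x \in RB q ->
  x \in coboundaries (hochschild V) q.
Proof.
move=> dx; case: theta_qi => _ /(_ q) iso.
by apply: (induces_iso_inj iso); apply/cocycles_hochschild.
Qed.

Lemma theta_lift q (y : cochain g V q) : y \in RZ q ->
  exists2 x : C q, hoch_d x = 0 & y - th x \in RB q.
Proof.
case: theta_qi => _ /(_ q) iso /(induces_iso_surj iso)[x /cocycles_hochschild dx e].
by exists x.
Qed.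

(** A total cocycle satisfies b x_q = - B x_{q+2}, and theta kills the right side; so theta of each
    component is a cocycle by itself. *)
Lemma theta_total_cocycle (x : fam) q : (forall r, x r \in normalized V r) ->
  total_d x = 0 -> th (x q) \in RZ q.
Proof.
move=> nx dx; apply/mk_subspaceP; split; first exact: theta_rel.
apply: etrans (esym (theta_hoch_d (x q))) _.
have := congr1 (fun y : fam => y q.+1) dx; rewrite total_dS => /eqP.
rewrite addr_eq0 => /eqP ->.
rewrite (linear_funN (@theta_linear _)) (theta_connes (nx _)).
exact: oppr0.
Qed.

Lemma theta_total_d (x : fam) q : (forall r, x r \in normalized V r) ->
  th (total_d x q) \in RB q.
Proof.
move=> nx; case: q => [|q]; first by rewrite total_d0 (theta_connes (nx _)); exact: rpred0.
rewrite total_dS (linear_funD (@theta_linear _)) (theta_connes (nx _)) addr0.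
exact: theta_boundary.
Qed.

(** The top component is a b-cocycle because nothing above it contributes, and theta detects that it
    is b-exact. *)
Lemma theta_total_injective p (x : fam) : x \in periodic_cochains V p ->
    total_d x = 0 -> (forall q, th (x q) \in RB q) ->
  exists2 y : fam, y \in periodic_cochains V (~~ p) & x = total_d y.
Proof.
move=> xper; have [[n xn] _ _] := (periodic_cochainsP p x).1 xper.
elim: n x xn xper => [|n IHn] x xn xper dx xB.
  exists 0; first exact: rpred0.
  by rewrite raddf0; apply: functional_extensionality_dep => q; exact: xn.
have [_ xp nx] := (periodic_cochainsP p x).1 xper.
have [xn0|xn_neq0] := eqVneq (x n) 0.
  apply: IHn => // q; rewrite leq_eqVlt => /orP[/eqP <-//|]; exact: xn.
have dxn : hoch_d (x n) = 0.
  have := congr1 (fun y : fam => y n.+1) dx; rewrite total_dS (xn n.+2) //.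
  by rewrite connes0 addr0.
have odd_n : odd n = p by apply/eqP; apply: contraNT xn_neq0 => /xp ->.
have := theta_exact dxn (xB n).
(* In degree 0 exactness means being 0, which is excluded here. *)
case: n xn IHn xn_neq0 dxn odd_n => [|n] xn IHn xn_neq0 dxn odd_n.
  by move/mk_subspaceP => x0; rewrite x0 eqxx in xn_neq0.
case/coboundaries_hochschild => y xy.
have [|y' ny' dy'] := @normalized_primitive _ _ _ V n y; first by rewrite -xy; exact: nx.
have per_y' : single y' \in periodic_cochains V (~~ p).
  by rewrite -odd_n /= negbK; exact: single_periodic.
have norm_y' r : single y' r \in normalized V r.
  by have [_ _] := (periodic_cochainsP _ _).1 per_y'.
(* The subtracted family lives in degrees n+1 and n-1 only and agrees with [x] in degree n+1, so the
   bound on the support drops. *)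
pose x' : fam := x - total_d (single y').
have x'E q : x' q = x q - total_d (single y') q by [].
have [||||z perz zE] := IHn x'.
- move=> q; rewrite x'E leq_eqVlt => /orP[/eqP <-|nq].
    by rewrite total_d_single_top dy' xy subrr.
  have qn1 : q != n.+1 by rewrite (gtn_eqF nq).
  have q1n : q.+1 != n by rewrite (gtn_eqF (leqW (ltnW nq))).
  rewrite (xn q nq) (total_d_single _ qn1 q1n); exact: subr0.
- apply: rpredB; first exact: xper.
  by rewrite -[p]negbK; exact: total_d_periodic.
- rewrite /x' (linear_funB (@total_d_is_linear _ _ HF V)) dx (total_d_total_d norm_y').
  exact: subr0.
- move=> q; rewrite x'E (linear_funB (@theta_linear q)).
  by apply: rpredB; [exact: xB | exact: theta_total_d].
exists (z + single y'); first by apply: rpredD.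
rewrite (linear_funD (@total_d_is_linear _ _ HF V)) -zE; exact: esym (subrK _ _).
Qed.

End Comparison.

(** * Surjectivity on periodic cohomology *)

Section Surjectivity.
Variables (K : fieldType) (F : comAlgType K) (HF : hopf F) (g : lieAlg K)
  (U : enveloping g) (P : hopf_pairing HF (env_hopf U)) (h l : {vspace g})
  (V : comodule HF).
Hypothesis theta_qi :
  @quasi_iso K (hochschild V) (rel_cpx P V h) (@theta _ _ _ _ _ P V h l).
Local Notation C q := (mtens V F q).
Local Notation fam := (gfamily (fun q => C q)).
Local Notation th := (@theta _ _ _ _ _ P V h l _).
Local Notation RZ q := (cocycles (rel_cpx P V h) q).
Local Notation RB q := (coboundaries (rel_cpx P V h) q).
Local Notation totl := (@total_d_is_linear _ _ HF V).
Local Notation hochl := (@hoch_d_is_linear _ _ HF V _).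
Local Notation connl := (@connes_is_linear _ _ HF V _).

(** Anticommutation makes B z a b-cocycle, and theta (B z) = 0; injectivity of theta on Hochschild
    cohomology yields a primitive. *)
Lemma connes_exact q (z : C q.+2) : z \in normalized V q.+2 -> connes (hoch_d z) = 0 ->
  exists2 y : C q, y \in normalized V q & hoch_d y = - connes z.
Proof.
move=> nz cdz; have dcz : hoch_d (connes z) = 0.
  by apply: oppr_inj; rewrite oppr0 -connes_hoch_d.
have thB : th (connes z) \in RB q.+1 by rewrite (theta_connes theta_qi nz); exact: rpred0.
have [y zy] := coboundaries_hochschild (theta_exact theta_qi dcz thB).
have [|y' ny' dy'] := @normalized_primitive _ _ _ V q y.
  by rewrite -zy; exact: normalized_connes.
exists (- y'); first by rewrite rpredN.
by rewrite (linear_funN hochl) dy' zy.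
Qed.

Lemma connes_exact0 (z : C 1) : z \in normalized V 1 -> connes (hoch_d z) = 0 ->
  connes z = 0.
Proof.
move=> nz cdz; have dcz : hoch_d (connes z) = 0.
  by apply: oppr_inj; rewrite oppr0 -connes_hoch_d.
have thB : th (connes z) \in RB 0 by rewrite (theta_connes theta_qi nz); exact: rpred0.
by have /mk_subspaceP := theta_exact theta_qi dcz thB.
Qed.

(** The condition B b z = 0, weaker than b z = 0, is what the recursion reproduces: the next
    component y has b y = - B z, hence B b y = - B B z = 0. The defect left in degree m+1 is b z. *)
Lemma total_extension m (z : C m) : z \in normalized V m -> connes (hoch_d z) = 0 ->
  exists x : fam, [/\ x \in periodic_cochains V (odd m),
    forall q, (m < q)%N -> x q = 0, x m = z &
    forall q, q != m.+1 -> total_d x q = 0].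
Proof.
elim/ltn_ind: m z => -[_|[_|m IHm]] z nz cdz.
- exists (single z); split; [exact: single_periodic| |exact: single_same|].
    by move=> q mq; apply: single_other; rewrite (gtn_eqF mq).
  by move=> q q1; apply: total_d_single.
- exists (single z); split; [exact: (single_periodic nz)| |exact: single_same|].
    by move=> q mq; apply: single_other; rewrite (gtn_eqF mq).
  move=> [_|q q2]; first by rewrite total_d_single_bot; exact: connes_exact0.
  exact: total_d_single.
have [y ny dy] := connes_exact nz cdz.
have [||x [xper xq xm dx]] := IHm m _ y ny; first exact: leqnSn.
  by rewrite dy (linear_funN connl) (connes_connes nz) oppr0.
exists (single z + x); split.
- apply: rpredD; first exact: single_periodic.
  by rewrite -[odd m.+2]/(~~ ~~ odd m) negbK.
- move=> q mq; have qm : q != m.+2 by rewrite (gtn_eqF mq).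
  apply: etrans (congr2 +%R (single_other _ qm) (xq q _)) _; last exact: addr0.
  exact: leq_trans (leqW (leqnSn m.+1)) mq.
- apply: etrans (congr2 +%R (single_same z) (xq m.+2 _)) _; last exact: addr0.
  exact: leqnSn.
move=> q qm; rewrite (linear_funD totl).
have [->|qm1] := eqVneq q m.+1; last first.
  apply: etrans (congr2 +%R (total_d_single _ qm _) (dx q qm1)) _; last exact: addr0.
  by rewrite eqSS.
have e2 : total_d x m.+1 = - connes z.
  by rewrite total_dS xm dy (xq m.+2 (leqnSn _)) connes0 addr0.
apply: etrans (congr2 +%R (total_d_single_bot z) e2) _; exact: subrr.
Qed.

Lemma normalized_cocycle m (w : C m) : hoch_d w = 0 ->
  exists w' : C m, [/\ w' \in normalized V m, hoch_d w' = 0 & th w - th w' \in RB m].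
Proof.
case: m w => [|m] w dw.
  exists w; split=> //; first exact/mk_subspaceP.
  by rewrite subrr; exact: rpred0.
have [|z nz] := @hoch_normalization _ _ _ V m w; first by rewrite dw; exact: rpred0.
exists (w - hoch_d z); split; first exact: nz.
  by rewrite (linear_funB hochl) dw hoch_d_hoch_d subr0.
rewrite -(linear_funB (@theta_linear _ _ _ _ _ _ _ _ _ theta_qi _)) opprB addrC subrK.
exact: theta_boundary.
Qed.

Lemma theta_total_surjective p (y : forall q, cochain g V q) n :
    (forall q, (n <= q)%N -> y q = 0) -> (forall q, odd q != p -> y q = 0) ->
    (forall q, y q \in RZ q) ->
  exists x : fam, [/\ x \in periodic_cochains V p, total_d x = 0 &
    forall q, y q - th (x q) \in RB q].
Proof.
have thl := theta_linear theta_qi.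
elim: n y => [|n IHn] y yn yp yZ.
  exists 0; split; [exact: rpred0 | exact: linear_fun0 totl | move=> q].
  by rewrite yn // (linear_fun0 (thl q)) subrr rpred0.
have [odd_n|odd_n] := eqVneq (odd n) p; last first.
  apply: IHn => // q; rewrite leq_eqVlt => /orP[/eqP <-|]; [exact: yp | exact: yn].
have [w dw wB] := theta_lift theta_qi (yZ n).
have [w' [nw' dw' wwB]] := normalized_cocycle dw.
have [|x1 [x1per x1q x1n dx1]] := total_extension nw'.
  by rewrite dw' connes0.
have {}dx1 : total_d x1 = 0.
  apply: functional_extensionality_dep => q; have [->|qn] := eqVneq q n.+1.
    by rewrite total_dS x1n dw' (x1q n.+2 (leqW (ltnSn _))) connes0 addr0.
  exact: dx1.
have [_ x1p x1norm] := (periodic_cochainsP _ _).1 x1per.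
(* In degree n the difference y_n - theta(x1_n) is a coboundary but need not be 0; it is cut off so
   that the induction hypothesis applies, and is accounted for at the end. *)
pose y' q : cochain g V q := if (q < n)%N then y q - th (x1 q) else 0.
have [|||x2 [x2per dx2 x2B]] := IHn y'.
- by move=> q nq; rewrite /y' ltnNge nq.
- move=> q qp; rewrite /y'; case: ifP => // _.
  rewrite (yp _ qp) x1p ?odd_n // (linear_fun0 (thl q)); exact: subr0.
- move=> q; rewrite /y'; case: ifP => _; last exact: rpred0.
  by apply: rpredB; [exact: yZ | exact: theta_total_cocycle].
exists (x1 + x2); split; first by apply: rpredD; rewrite // -odd_n.
  by rewrite (linear_funD totl) dx1 dx2; exact: addr0.
move=> q; have -> : y q - th ((x1 + x2) q) = (y q - th (x1 q) - y' q) + (y' q - th (x2 q)).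
  by rewrite (linear_funD (thl q)) addrA subrK opprD addrA.
apply: rpredD; last exact: x2B.
rewrite /y'; case: (ltngtP q n) => [qn|nq|->].
- by rewrite subrr; exact: rpred0.
- rewrite (yn q nq) (x1q q nq) (linear_fun0 (thl q)) !subr0; exact: rpred0.
rewrite subr0 x1n -(subrK (th w) (y n)) -addrA; apply: rpredD => //.
Qed.

End Surjectivity.

(** * The isomorphism induced by theta *)

Section Isomorphism.
Variables (K : fieldType) (F : comAlgType K) (HF : hopf F) (g : lieAlg K)
  (U : enveloping g) (P : hopf_pairing HF (env_hopf U)) (h l : {vspace g})
  (V : comodule HF) (p : bool).
Hypothesis theta_qi :
  @quasi_iso K (hochschild V) (rel_cpx P V h) (@theta _ _ _ _ _ P V h l).
Local Notation Z := (periodic_cocycles V p).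
Local Notation th := (@theta _ _ _ _ _ P V h l _).
Local Notation RZ q := (cocycles (rel_cpx P V h) q).
Local Notation RB q := (coboundaries (rel_cpx P V h) q).
Local Notation HR := (rel_cohomology P V h).

Lemma periodic_cocyclesP (z : subm Z) :
  val z \in periodic_cochains V p /\ total_d (val z) = 0.
Proof. by have /mk_subspaceP := valP z. Qed.

Definition theta_family (z : subm Z) : gfamily HR :=
  fun q => class_at (RZ q) (RB q) (th (val z q)).

Lemma theta_cocycle (z : subm Z) q : th (val z q) \in RZ q.
Proof.
have [zper dz] := periodic_cocyclesP z; have [_ _ nz] := (periodic_cochainsP _ _).1 zper.
exact: theta_total_cocycle.
Qed.

Lemma theta_family_eq0 (z : subm Z) q : val z q = 0 -> theta_family z q = 0.
Proof.
move=> z0; apply/(class_at_eq0 _ (theta_cocycle z q)).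
by rewrite z0 (linear_fun0 (theta_linear theta_qi (q := q))); exact: rpred0.
Qed.

Lemma theta_family_in (z : subm Z) :
  theta_family z \in parity_sum p (fun q => full_sub (HR q)).
Proof.
have [zper dz] := periodic_cocyclesP z.
have [[n zn] zp _] := (periodic_cochainsP _ _).1 zper; apply/mk_subspaceP; split.
- by exists n => q /zn /theta_family_eq0.
- by move=> q /zp /theta_family_eq0.
by move=> q; exact: in_full.
Qed.

Definition theta_dsum (z : subm Z) : dsum HR p := SubM (theta_family_in z).

Lemma theta_dsum_linear : linear theta_dsum.
Proof.
move=> a x y; apply: val_inj; apply: functional_extensionality_dep => q.
apply: etrans _ (class_at_linear _ a (theta_cocycle x q) (theta_cocycle y q)).
congr (class_at _ _ _); exact: (theta_linear theta_qi).
Qed.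

Lemma theta_dsum_eq0 (z : subm Z) :
  theta_dsum z = 0 <-> val z \in periodic_coboundaries V p.
Proof.
have [zper dz] := periodic_cocyclesP z.
split=> [e|/mk_subspaceP[y /periodic_cochainsP[_ _ ny] zy]].
  apply/mk_subspaceP; apply: (theta_total_injective theta_qi zper dz) => q.
  apply/(class_at_eq0 _ (theta_cocycle z q)).
  exact: (congr1 (fun x : dsum HR p => dsum_coord x q) e).
apply: val_inj; apply: functional_extensionality_dep => q.
apply/(class_at_eq0 _ (theta_cocycle z q)); rewrite zy.
exact: theta_total_d.
Qed.

Lemma theta_dsum_surj (n : dsum HR p) : exists z, theta_dsum z = n.
Proof.
have /mk_subspaceP[[N nN] np _] := valP n.
(* A zero class is represented by the zero cochain, so that the representatives inherit the finite
   support and the parity of [n]. *)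
have coord q : exists y : cochain g V q,
    [/\ y \in RZ q, dsum_coord n q = 0 -> y = 0 & class_at (RZ q) (RB q) y = dsum_coord n q].
  have [e|ne] := eqVneq (dsum_coord n q) 0.
    exists 0; split=> //; first exact: rpred0.
    by rewrite e; apply/class_at_eq0; exact: rpred0.
  have [z zn] := class_ofP (dsum_coord n q).
  exists (val z); split; first exact: valP.
    by move=> e; rewrite e eqxx in ne.
  by rewrite class_atE.
pose y q := sval (cid (coord q)).
have yZ q : y q \in RZ q by rewrite /y; case: cid => ? [].
have y0 q : dsum_coord n q = 0 -> y q = 0 by rewrite /y; case: cid => ? [].
have yn q : class_at (RZ q) (RB q) (y q) = dsum_coord n q.
  by rewrite /y; case: cid => ? [].
have yN q : (N <= q)%N -> y q = 0 by move=> /nN /y0.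
have yp q : odd q != p -> y q = 0 by move=> /np /y0.
have [x [xper dx xB]] := theta_total_surjective theta_qi yN yp yZ.
have xZ : x \in Z by apply/mk_subspaceP; split.
exists (SubM xZ); apply: val_inj; apply: functional_extensionality_dep => q.
rewrite -[RHS]/(dsum_coord n q) -yn; apply/esym/class_at_eq; last exact: xB.
  exact: yZ.
exact: (theta_cocycle (SubM xZ)).
Qed.

End Isomorphism.

Theorem theorem4p3 (R : realType) (F : comAlgType R[i]) (HF : hopf F)
    (g : lieAlg R[i]) (U : enveloping g)
    (P : hopf_pairing HF (env_hopf U)) (h l : {vspace g})
    (levi : levi_decomposition P h l)
    (V : comodule HF) (p : bool) :
  exists Theta : {linear HP V p -> dsum (rel_cohomology P V h) p},
    bijective Theta /\
    forall (c : HP V p) (x : gfamily (fun q : nat => mtens V F q)),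
      has_class c x ->
      forall q, has_class (dsum_coord (Theta c) q) (theta P h l (x q)).
Proof.
have qi := levi_theta levi V.
have [T [Tbij TE]] := subquot_iso (@theta_dsum_linear _ _ _ _ _ _ _ _ _ p qi) (theta_dsum_eq0 qi)
  (theta_dsum_surj qi).
exists T; split=> // c x [z [<- <-]] q.
rewrite TE; exact: (has_class_at _ (theta_cocycle qi z q)).
Qed.
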